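(* Assume condition (H). Suppose $G(\theta,\cdot)$ is Borel measurable with $G(\theta,Z_1)\in H^{\Phi^*}$ for every $\theta\in\Theta$, and $\Phi^*(G(\bar\theta,Z_1)+\bar x)$ is square integrable for some $(\bar\theta,\bar x)\in\Theta\times\mathbb R$. Then (A1), (A3) and (A4) hold, and (A5) holds with $\bar d$ equal to the Euclidean metric on $\Theta\times\mathbb R\subseteq\mathbb R^{m+1}$.
   Context: Setup: $Z_1,Z_2,\dots$ i.i.d. $\mathbb R^d$-valued random vectors with law $\mathbb P^Z$ on a probability space $(\Omega,\mathcal F,\mathbb P)$; $\Theta\subseteq\mathbb R^m$ nonempty compact; $G:\Theta\times\mathbb R^d\to\mathbb R$; $\Phi:[0,\infty[\to[0,\infty]$ lower semicontinuous convex with $\Phi(0)<\infty$, $\Phi(x_0)<\infty$ for some $x_0>1$, $\inf\Phi=0$, $\Phi(x)/x\to\infty$; $\Phi^*(y)=\sup_{x\ge0}(xy-\Phi(x))$; $H^{\Phi^*}=\{X:\mathbb E[\Phi^*(c|X|)]<\infty\ \forall c>0\}$. $h_{(\theta,x)}(z)=\Phi^*(G(\theta,z)+x)$; $(\mathbb P_n-\mathbb P)(h)=\frac1n\sum_{j\le n}(h(Z_j)-\mathbb E h(Z_j))$. (H): there exist $\beta\in]0,1]$ and square $\mathbb P^Z$-integrable $C_k:\mathbb R^d\to]0,\infty[$ with $|\Phi^*(G(\theta,z)+x)-\Phi^*(G(\vartheta,z)+y)|\le C_k(z)\|(\theta,x)-(\vartheta,y)\|_2^\beta$ for all $z$, $\theta,\vartheta\in\Theta$,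 $k\in\mathbb N$, $x,y\in[-k,k]$. (A1) $G$ is $\mathcal B(\Theta)\otimes\mathcal B(\mathbb R^d)$-measurable and $G(\cdot,z)$ lower semicontinuous for all $z$. (A3) $G(\theta,Z_1)\in H^{\Phi^*}$ for all $\theta$ and $\sup_\theta|\Phi^*(G(\theta,z))|\le\xi_2(z)$ for some $\mathbb P^Z$-integrable $\xi_2$. (A4) $\Phi^*(G(\theta,Z_1)+x)$ square integrable for all $(\theta,x)$ and $\sup_{\theta,|x|\le k}\mathbb E[\Phi^*(G(\theta,Z_1)+x)]<\infty$ for all $k$. (A5) for the semimetric $\bar d$ (totally bounded on each $\Theta\times[-k,k]$): for all $\varepsilon>0$, $k\in\mathbb N$, $\lim_{\delta\to0+}\limsup_n\mathbb P^*(\sup_{\gamma_1,\gamma_2\in\Theta\times[-k,k],\bar d(\gamma_1,\gamma_2)<\delta}\sqrt n|(\mathbb P_n-\mathbb P)(h_{\gamma_1}-h_{\gamma_2})|>\varepsilon)=0$, $\mathbb P^*$ outer probability. *)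

(* Defs.v *)
From HB Require Import structures.
From mathcomp Require Import all_boot all_order all_algebra.
From mathcomp Require Import all_classical all_reals all_analysis.
Import Order.TTheory GRing.Theory Num.Theory.
Import numFieldNormedType.Exports.

Set Implicit Arguments.
Unset Strict Implicit.
Unset Printing Implicit Defensive.

Local Open Scope classical_set_scope.
Local Open Scope ring_scope.

Definition Rvec (R : realType) (n : nat) := g_sigma_algebraType (@open 'rV[R]_n).

Definition eucl_dist (R : realType) (m : nat) (p q : 'rV[R]_m * R) : R :=
  Num.sqrt (\sum_(i < m) (p.1 0 i - q.1 0 i) ^+ 2 + (p.2 - q.2) ^+ 2).

(* Phi : [0,oo[ -> [0,oo] is represented by a function R -> \bar R whose
   values on ]-oo,0[ are irrelevant. *)

Definition lsc_nonneg (R : realType) (Phi : R -> \bar R) :=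
  forall x, 0 <= x -> forall a : R, (a%:E < Phi x)%E ->
    exists2 e : R, 0 < e & forall y, 0 <= y -> `|y - x| < e -> (a%:E < Phi y)%E.

Definition convex_nonneg (R : realType) (Phi : R -> \bar R) :=
  forall x y t : R, 0 <= x -> 0 <= y -> 0 <= t <= 1 ->
    (Phi (t * x + (1 - t) * y)%R <= t%:E * Phi x + (1 - t)%:E * Phi y)%E.

Definition Phi_assumptions (R : realType) (Phi : R -> \bar R) :=
  (forall x, 0 <= x -> (0 <= Phi x)%E) /\
  lsc_nonneg Phi /\ convex_nonneg Phi /\
  (Phi 0%R < +oo)%E /\
  (exists2 x0 : R, 1 < x0 & (Phi x0 < +oo)%E) /\
  ereal_inf (Phi @` [set x | 0 <= x]) = 0%E /\
  ((Phi x * (x^-1)%:E)%E @[x --> +oo] --> +oo%E).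

(* Fenchel-Legendre transform Phi^*(y) = sup_{x >= 0} (x y - Phi x).
   Under Phi_assumptions this supremum is a real number; we return it in R. *)
Definition conjPhi (R : realType) (Phi : R -> \bar R) (y : R) : R :=
  fine (ereal_sup [set ((x * y)%:E - Phi x)%E | x in [set x : R | 0 <= x]]).

Definition Hclass d (Omega : measurableType d) (R : realType)
    (P : probability Omega R) (PhiS : R -> R) (X : Omega -> R) :=
  measurable_fun setT X /\
  forall c : R, 0 < c -> (\int[P]_w (PhiS (c * `|X w|))%:E < +oo)%E.

Definition sq_integrable d (Omega : measurableType d) (R : realType)
    (P : probability Omega R) (X : Omega -> R) :=
  measurable_fun setT X /\ (\int[P]_w ((X w) ^+ 2)%:E < +oo)%E.

(* Z_1, Z_2, ... (indexed here by 0, 1, ...) i.i.d. R^d-valued random vectors *)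
Definition iid d (Omega : measurableType d) (R : realType)
    (P : probability Omega R) (dd : nat) (Z : nat -> Omega -> Rvec R dd) :=
  (forall n, measurable_fun setT (Z n)) /\
  (forall n (B : set (Rvec R dd)), measurable B ->
     P (Z n @^-1` B) = P (Z 0%N @^-1` B)) /\
  (forall (s : seq nat) (B : nat -> set (Rvec R dd)), uniq s ->
     (forall i, measurable (B i)) ->
     P (\big[setI/setT]_(i <- s) (Z i @^-1` B i)) =
     (\prod_(i <- s) P (Z i @^-1` B i))%E).

Definition Pouter d (Omega : measurableType d) (R : realType)
    (P : probability Omega R) (A : set Omega) : \bar R :=
  ereal_inf [set P B | B in [set B | measurable B /\ A `<=` B]].

Definition emp_dev d (Omega : measurableType d) (R : realType)
    (P : probability Omega R) (dd : nat) (Z : nat -> Omega -> Rvec R dd)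
    (h : Rvec R dd -> R) (n : nat) (w : Omega) : R :=
  n%:R^-1 * \sum_(j < n) (h (Z j w) - fine (\int[P]_v (h (Z j v))%:E)).

Definition hfun (R : realType) (m dd : nat) (PhiS : R -> R)
    (G : 'rV[R]_m -> Rvec R dd -> R) (g : 'rV[R]_m * R) (z : Rvec R dd) : R :=
  PhiS (G g.1 z + g.2).

Definition condH d (Omega : measurableType d) (R : realType)
    (P : probability Omega R) (m dd : nat) (Z : nat -> Omega -> Rvec R dd)
    (Theta : set 'rV[R]_m) (PhiS : R -> R) (G : 'rV[R]_m -> Rvec R dd -> R) :=
  exists2 beta : R, 0 < beta <= 1 &
  exists C : nat -> Rvec R dd -> R,
    (forall k z, 0 < C k z) /\
    (forall k, measurable_fun setT (C k) /\
       (\int[pushforward P (Z 0%N)]_z ((C k z) ^+ 2)%:E < +oo)%E) /\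
    (forall (k : nat) z th vt (x y : R), Theta th -> Theta vt ->
       `|x| <= k%:R -> `|y| <= k%:R ->
       `|PhiS (G th z + x) - PhiS (G vt z + y)| <=
         C k z * (eucl_dist (th, x) (vt, y)) `^ beta).

Definition condA1 (R : realType) (m dd : nat) (Theta : set 'rV[R]_m)
    (G : 'rV[R]_m -> Rvec R dd -> R) :=
  measurable_fun (Theta `*` setT : set (Rvec R m * Rvec R dd))
    (fun p => G p.1 p.2) /\
  forall z, forall th, Theta th -> forall a : R, a < G th z ->
    \forall vt \near th, Theta vt -> a < G vt z.

Definition condA3 d (Omega : measurableType d) (R : realType)
    (P : probability Omega R) (m dd : nat) (Z : nat -> Omega -> Rvec R dd)
    (Theta : set 'rV[R]_m) (PhiS : R -> R) (G : 'rV[R]_m -> Rvec R dd -> R) :=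
  (forall th, Theta th -> Hclass P PhiS (fun w => G th (Z 0%N w))) /\
  exists xi2 : Rvec R dd -> R,
    (pushforward P (Z 0%N)).-integrable setT (fun z => (xi2 z)%:E) /\
    forall z, (ereal_sup [set (`|PhiS (G th z)|)%:E | th in Theta]
                <= (xi2 z)%:E)%E.

Definition condA4 d (Omega : measurableType d) (R : realType)
    (P : probability Omega R) (m dd : nat) (Z : nat -> Omega -> Rvec R dd)
    (Theta : set 'rV[R]_m) (PhiS : R -> R) (G : 'rV[R]_m -> Rvec R dd -> R) :=
  (forall th (x : R), Theta th ->
     sq_integrable P (fun w => PhiS (G th (Z 0%N w) + x))) /\
  forall k : nat,
    (ereal_sup [set \int[P]_w (PhiS (G g.1 (Z 0%N w) + g.2)%R)%:E
               | g in [set g : 'rV[R]_m * R | Theta g.1 /\ (`|g.2| <= k%:R)%R]]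
      < +oo)%E.

Definition condA5 d (Omega : measurableType d) (R : realType)
    (P : probability Omega R) (m dd : nat) (Z : nat -> Omega -> Rvec R dd)
    (Theta : set 'rV[R]_m) (PhiS : R -> R) (G : 'rV[R]_m -> Rvec R dd -> R)
    (dbar : 'rV[R]_m * R -> 'rV[R]_m * R -> R) :=
  forall (eps : R), 0 < eps -> forall k : nat,
    (limn_esup (fun n : nat => Pouter P
       [set w | (eps%:E < ereal_sup
          [set (Num.sqrt n%:R *
                `|emp_dev P Z (fun z => hfun PhiS G gg.1 z - hfun PhiS G gg.2 z)
                    n w|)%:E
          | gg in [set gg : ('rV[R]_m * R) * ('rV[R]_m * R) |
                    ([/\ Theta gg.1.1, `|gg.1.2| <= k%:R,
                        Theta gg.2.1, `|gg.2.2| <= k%:R &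
                        dbar gg.1 gg.2 < delta])%R]])%E])
      @[delta --> 0^'+] --> 0%E).

(* Main.v *)
(* The real content is asymptotic equicontinuity. Put C := C_k. On the event
   that C(Z_j) <= sqrt n for all j <= n, whose complement has probability at most
   E[C^2; C > sqrt n] -> 0, every function h of the class may be replaced by
   h 1{C <= sqrt n}, at the price of a recentering which is again of order
   E[C^2; C > sqrt n]. The increments of the truncated functions are bounded by
   sqrt n |p - q|^beta and have second moment at most E[C^2] |p - q|^(2 beta),
   so the mgf of their normalised sums gives, uniformly in n,
     P(|X_n p - X_n q| > 4 t |p - q|^beta) <= 2 exp(E[C^2] - t).
   These tails beat the polynomial cardinality of grid nets in R^(m+1), and
   chaining over the nets concludes: no symmetrisation is needed.
   For (A1), Phi^* is nondecreasing and unbounded, hence for a < b some shift x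
   satisfies Phi^*(a + x) < Phi^*(b + x); continuity of
   theta |-> Phi^*(G(theta, z) + x) then passes to G(., z). *)

Require Import Defs.
From HB Require Import structures.
From mathcomp Require Import all_boot all_order all_algebra.
From mathcomp Require Import all_classical all_reals all_analysis measurable_realfun.
From mathcomp Require Import ring lra.
Import Order.TTheory GRing.Theory Num.Theory.
Import numFieldNormedType.Exports.
Local Open Scope classical_set_scope.
Local Open Scope ring_scope.

Set Implicit Arguments.
Unset Strict Implicit.
Unset Printing Implicit Defensive.

(** * The convex conjugate *)

(** Truncation level and normalisation are matched: divided by [sqrt n], a truncated increment is of
    order [|p - q|^beta] uniformly in [n], so an exponential moment with parameter of order
    [|p - q|^(- beta)] stays in the range where [exp y] lies below a quadratic polynomial. The
    resulting tail has an exponent linear in [t]. This is enough because the nets have only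
    [2^(c i)] points: at level [i], where increments have size about [r^(2 i)], the threshold [r^i]
    is still summable, yet exceeded only with probability decaying faster than any geometric
    sequence. The truncation depends on [C] alone, hence is linear in [h], and one exceptional event
    serves all pairs of indices. The supremum over an uncountable index set need not be measurable.
    Probabilities are therefore estimated only for countable unions of events attached to pairs of
    net points. The passage from the nets to the whole index set is pathwise: it uses a crude Hölder
    bound whose constant grows with [n] but affects only the vanishing end of a chain. *)

Section conjugate.
Context {R : realType} (Phi : R -> \bar R).
Hypothesis hPhi : Phi_assumptions Phi.

Let conj_set (y : R) : set (\bar R) :=
  [set ((x * y)%:E - Phi x)%E | x in [set x : R | 0 <= x]].

(** Superlinear growth makes [x y - Phi x] nonpositive beyond some [M], and [0 <= Phi] bounds it by
    [M |y|] before [M]. From below, the term at [x = 0] is [- Phi 0], which is finite. *)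
Lemma conjPhi_fin_num y : ereal_sup (conj_set y) \is a fin_num.
Proof.
case: hPhi => Phi_ge0 [_ [_ [Phi0 [_ [_ Phi_superlinear]]]]].
have [M M1 Mb] : exists2 M : R, 0 < M &
    forall x, M <= x -> ((x * (`|y| + 1))%:E <= Phi x)%E.
  move/cvgeyPge : Phi_superlinear => /(_ (`|y| + 1)) [M [_ HM]].
  exists (`|M| + 1); first by rewrite ltr_wpDl.
  move=> x Mx; have x0 : 0 < x by apply: lt_le_trans Mx; rewrite ltr_wpDl.
  have {}HM : ((`|y| + 1)%:E <= Phi x * (x^-1)%:E)%E.
    by apply: HM; apply: lt_le_trans Mx; rewrite ltr_pwDr// ler_norm.
  rewrite mulrC EFinM; apply: (@le_trans _ _ ((Phi x * (x^-1)%:E) * x%:E)%E).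
    by rewrite lee_pmul2r.
  by rewrite -muleA -EFinM mulVf ?mule1// gt_eqF.
rewrite fin_numElt; apply/andP; split.
  apply: (@lt_le_trans _ _ (- Phi 0)%E).
    by rewrite lteNr.
  apply: ereal_sup_ubound; exists 0 => //=.
  by rewrite mul0r add0e.
apply: (@le_lt_trans _ _ (M * `|y|)%:E); last by rewrite ltry.
apply: ge_ereal_sup => _ [x /= x0 <-].
have [xM|Mx] := leP x M.
  apply: (@le_trans _ _ (x * y)%:E).
    by rewrite geeDl// oppe_le0 Phi_ge0.
  rewrite lee_fin (@le_trans _ _ (x * `|y|))// ?ler_wpM2l// ?ler_norm//.
  by rewrite ler_wpM2r.
apply: (@le_trans _ _ 0%E); last by rewrite lee_fin mulr_ge0// ltW.
rewrite sube_le0; apply: le_trans (Mb _ (ltW Mx)).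
rewrite lee_fin ler_wpM2l// (le_trans (ler_norm y))//.
by rewrite lerDl.
Qed.

Lemma conjPhi_nondecreasing : {homo conjPhi Phi : x y / x <= y}.
Proof.
move=> a b ab; apply: fine_le; try exact: conjPhi_fin_num.
apply: ge_ereal_sup => _ [x /= x0 <-].
apply: (@le_trans _ _ ((x * b)%:E - Phi x)%E).
  by rewrite leeD2r// lee_fin ler_wpM2l.
by apply: ereal_sup_ubound; exists x.
Qed.

(** The point [x0] where [Phi] is finite gives the affine minorant [x0 y - Phi x0], of positive
    slope. Unboundedness is stated along an arithmetic progression so that an inequality between the
    values at [a + x] and [b + x] can be iterated. *)
Lemma conjPhi_unbounded (a b M : R) : a < b ->
  exists n : nat, M < conjPhi Phi (a + n%:R * (b - a)).
Proof.
move=> ab; case: hPhi => Phi_ge0 [_ [_ [_ [[x0 x01 Phix0] _]]]].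
have x00 : 0 < x0 by rewrite (lt_trans _ x01).
have Phix0fin : Phi x0 \is a fin_num.
  by rewrite ge0_fin_numE// Phi_ge0// ltW.
set c := fine (Phi x0).
have cE : Phi x0 = c%:E by rewrite fineK.
set n := Num.truncn ((`|M + c| + x0 * `|a|) / (x0 * (b - a))).
exists n.+1.
have lb : x0 * (a + n.+1%:R * (b - a)) - c
    <= conjPhi Phi (a + n.+1%:R * (b - a)).
  rewrite -lee_fin fineK; last exact: conjPhi_fin_num.
  apply: ereal_sup_ubound; exists x0; first exact: ltW.
  by rewrite cE EFinB.
apply: lt_le_trans lb.
have d0 : 0 < x0 * (b - a) by rewrite mulr_gt0// subr_gt0.
have : (`|M + c| + x0 * `|a|) < n.+1%:R * (x0 * (b - a)).
  by rewrite -ltr_pdivrMr// truncnS_gt.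
have := ler_norm (M + c); have : - a <= `|a| by rewrite -normrN ler_norm.
move: x00 (normr_ge0 a) => /[swap] _.
move=> x00; rewrite -(ler_pM2l x00) => h1 h2 h3.
have -> : x0 * (a + n.+1%:R * (b - a)) - c =
  n.+1%:R * (x0 * (b - a)) - x0 * - a - c by ring.
lra.
Qed.

(* If the conjugate agreed at [a + x] and [b + x] for all x, it would be
   bounded along [a + n (b - a)]. *)
Lemma conjPhi_separates (a b : R) : a < b ->
  exists x, conjPhi Phi (a + x) < conjPhi Phi (b + x).
Proof.
move=> ab; apply: contrapT => /forallNP H.
have {}H x : conjPhi Phi (b + x) <= conjPhi Phi (a + x).
  by rewrite leNgt; apply/negP/H.
have [n] := conjPhi_unbounded (conjPhi Phi a) ab.
apply/negP; rewrite -leNgt; elim: n => [|n ih]; first by rewrite mul0r addr0.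
apply: le_trans ih; apply: le_trans (H _).
by apply: conjPhi_nondecreasing; rewrite -natr1; lra.
Qed.

Lemma measurable_conjPhi : measurable_fun setT (conjPhi Phi).
Proof. by apply: nondecreasing_measurable => //; exact: conjPhi_nondecreasing. Qed.

End conjugate.

(** * Nets and chaining *)

Section index_space.
Context {R : realType} {m : nat}.
Implicit Types p q : 'rV[R]_m * R.

Lemma rV_norm_leP n (v : 'rV[R]_n) (c : R) : 0 <= c ->
  (forall i, `|v 0 i| <= c) -> `|v| <= c.
Proof.
move=> c0 H; rewrite [`|v|]mx_normrE.
by apply: bigmax_le => // -[i j] _; rewrite (ord1 i) H.
Qed.

Lemma rV_coord_le_norm n (v : 'rV[R]_n) i : `|v 0 i| <= `|v|.
Proof.
rewrite [`|v|]mx_normrE.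
exact: (@le_bigmax _ _ _ 0 (fun ij : 'I_1 * 'I_n => `|v ij.1 ij.2|) (0, i)).
Qed.

(** Chaining is done in the sup norm of the product, which suits the grid. This bound transfers the
    conclusion to the Euclidean metric of (A5); the reverse comparison below transfers the Hölder
    hypothesis. *)
Lemma norm_le_eucl_dist p q : `|p - q| <= eucl_dist p q.
Proof.
have sq_le x : x ^+ 2 <= \sum_(i < m) (p.1 0 i - q.1 0 i) ^+ 2 + (p.2 - q.2) ^+ 2
    -> `|x| <= eucl_dist p q by move=> ?; rewrite -sqrtr_sqr ler_wsqrtr.
rewrite prod_normE ge_max; apply/andP; split.
  apply: rV_norm_leP => [|i]; first exact: sqrtr_ge0.
  rewrite !mxE; apply: sq_le.
  rewrite (bigD1 i)//= -addrA lerDl addr_ge0 ?sqr_ge0// sumr_ge0// => j _.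
  exact: sqr_ge0.
by apply: sq_le; rewrite lerDr sumr_ge0// => i _; exact: sqr_ge0.
Qed.

Lemma eucl_dist_le_norm p q : eucl_dist p q <= Num.sqrt m.+1%:R * `|p - q|.
Proof.
rewrite -[X in _ * X]normr_id -sqrtr_sqr -sqrtrM ?ler0n// ler_wsqrtr//.
have sqr_le (x : R) : `|x| <= `|p - q| -> x ^+ 2 <= `|p - q| ^+ 2.
  by move=> h; rewrite -(real_normK (num_real x)) ler_sqr ?nnegrE.
rewrite -natr1 mulrDl mul1r lerD//.
  have -> : m%:R * `|p - q| ^+ 2 = \sum_(i < m) `|p - q| ^+ 2.
    by rewrite sumr_const card_ord mulr_natl.
  apply: ler_sum => i _; apply: sqr_le.
  rewrite (le_trans _ (_ : `|p.1 - q.1| <= _))//.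
    by have := rV_coord_le_norm (p.1 - q.1) i; rewrite !mxE.
  by rewrite [leRHS]prod_normE le_max lexx.
by apply: sqr_le; rewrite [leRHS]prod_normE le_max lexx orbT.
Qed.

(* The nets pick one point of K in each cell of the grid of mesh [2^-i]. *)
Lemma bounded_nets (K : set ('rV[R]_m * R)) (L : nat) :
  (forall p, K p -> `|p| <= L%:R) -> K !=set0 ->
  exists (A B : nat) (net : nat -> seq ('rV[R]_m * R)), forall i,
    [/\ forall s, s \in net i -> K s,
        (size (net i) <= A * B ^ i)%N &
        forall p, K p -> exists2 s, s \in net i & `|p - s| <= 2^-1 ^+ i].
Proof.
move=> KL [p0 Kp0].
(* Shifted by [L] and scaled by [2 ^ i], a coordinate lies in [[0, 2 L 2 ^ i]]; taking [2 L + 1] in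
   place of [2 L] leaves room for the right endpoint. *)
pose N i := ((L.*2.+1) * 2 ^ i)%N.
have N_gt0 i : (0 < N i)%N by rewrite muln_gt0 expn_gt0.
pose cell i (x : R) : 'I_(N i) :=
  insubd (Ordinal (N_gt0 i)) (Num.truncn ((x + L%:R) * 2 ^+ i)).
have cell_eq i x y : `|x| <= L%:R -> `|y| <= L%:R -> cell i x = cell i y ->
    `|x - y| <= 2^-1 ^+ i.
  have p2 : 0 < 2 ^+ i :> R by rewrite exprn_gt0.
  have bnd (z : R) : `|z| <= L%:R -> 0 <= (z + L%:R) * 2 ^+ i /\
      (Num.truncn ((z + L%:R) * 2 ^+ i) < N i)%N.
    rewrite ler_norml => /andP[zL1 zL2].
    have z0 : 0 <= (z + L%:R) * 2 ^+ i by rewrite mulr_ge0 ?(ltW p2)// -lerBlDr sub0r.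
    split=> //; rewrite truncn_lt_nat// /N natrM natrX ltr_pM2r//.
    by rewrite -natr1 -addnn natrD; lra.
  move=> /bnd[x0 xN] /bnd[y0 yN] /(congr1 val); rewrite /cell !val_insubd xN yN => E.
  rewrite exprVn -[_ ^- i]mul1r ler_pdivlMr// -[2 ^+ i]gtr0_norm// -normrM.
  have := truncnS_gt ((x + L%:R) * 2 ^+ i).
  have := truncnS_gt ((y + L%:R) * 2 ^+ i).
  have := truncn_le ((x + L%:R) * 2 ^+ i); rewrite x0.
  have := truncn_le ((y + L%:R) * 2 ^+ i); rewrite y0.
  rewrite E -natr1.
  have -> : (x - y) * 2 ^+ i = (x + L%:R) * 2 ^+ i - (y + L%:R) * 2 ^+ i by ring.
  rewrite ler_norml; lra.
pose F i : finType := ({ffun 'I_m -> 'I_(N i)} * 'I_(N i))%type.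
pose code i p : F i := ([ffun j => cell i (p.1 0 j)], cell i p.2).
(* The default [p0] for a cell that misses K keeps every net point inside K, where the Hölder bound
   and the integrability hold. *)
pose pt i (c : F i) := xget p0 [set p | K p /\ code i p = c].
have ptK i c : K (pt i c).
  by rewrite /pt; case: xgetP => [p _ []|].
exists (L.*2.+1 ^ m.+1)%N, (2 ^ m.+1)%N, (fun i => [seq pt i c | c <- enum (F i)]).
move=> i; split.
- by move=> s /mapP[c _ ->].
- rewrite size_map -cardE card_prod card_ffun !card_ord -expnSr /N expnMn.
  by rewrite -!expnM (mulnC i).
- move=> p Kp; exists (pt i (code i p)).
    by apply: map_f; rewrite mem_enum.
  rewrite /pt; case: xgetP => [q _ [Kq] [E1 E2]|/(_ p) H]; last first.
    by exfalso; apply: H.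
  have coordL r : K r -> (forall j, `|r.1 0 j| <= L%:R) /\ `|r.2| <= L%:R.
    move=> /KL; rewrite prod_normE ge_max => /andP[r1 r2]; split => // j.
    exact: le_trans (rV_coord_le_norm _ _) r1.
  have [p1 p2] := coordL _ Kp; have [q1 q2] := coordL _ Kq.
  rewrite prod_normE ge_max; apply/andP; split; last exact: cell_eq.
  apply: rV_norm_leP => [|j]; first by rewrite exprn_ge0.
  rewrite !mxE; apply: cell_eq => //.
  by have := congr1 (fun f : {ffun _ -> _} => f j) E1; rewrite !ffunE.
Qed.

End index_space.

(** These are all the links used by the chaining. A vertical link, from level [i] to [i.+1], has
    length at most [3/2] times [2^-1 ^+ i]; a horizontal one, joining the chains of two close
    points, less than [3] times. The factor 4 covers both. *)
Definition net_pairs {R : realType} {V : normedModType R} (net : nat -> seq V)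
    (i : nat) : seq (V * V) :=
  [seq st <- [seq (s, t) | s <- net i, t <- net i ++ net i.+1]
  | `|st.1 - st.2| <= 4 * 2^-1 ^+ i].

Lemma net_pairsP {R : realType} {V : normedModType R} (net : nat -> seq V) i s t :
  reflect [/\ s \in net i, t \in net i ++ net i.+1 & `|s - t| <= 4 * 2^-1 ^+ i]
          ((s, t) \in net_pairs net i).
Proof.
rewrite mem_filter; apply: (iffP andP) => /=.
  by move=> [st /allpairsP[[s' t'] /= [? ? [es et]]]]; rewrite es et in st *; split.
by move=> [? ? ?]; split => //; apply/allpairsP; exists (s, t).
Qed.

Lemma size_net_pairs {R : realType} {V : normedModType R} (net : nat -> seq V)
    (A B i : nat) : (forall j, size (net j) <= A * B ^ j)%N ->
  (size (net_pairs net i) <= (A ^ 2 * (1 + B)) * (B ^ 2) ^ i)%N.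
Proof.
move=> netAB; rewrite size_filter (leq_trans (count_size _ _))//.
rewrite size_allpairs size_cat (leq_trans (leq_mul (netAB i)
  (leq_add (netAB i) (netAB i.+1))))//.
have -> : ((B ^ 2) ^ i = B ^ i * B ^ i)%N by rewrite -expnMn mulnn.
  by rewrite (expnS B i) eq_leq// expnS expn1; ring.
Qed.

(** A deterministic statement about one path. The chains of [p] and [q] each cost at most the
    geometric sum [r ^+ i0 / (1 - r)], and the link joining them at level [i0] costs [r ^+ i0]. The
    constant [M] is absent from the conclusion: it only makes the end of each chain converge, so it
    may depend on [n]. *)
Lemma chaining {R : realType} {V : normedModType R} (K : set V) (X : V -> R)
    (net : nat -> seq V) (M beta r : R) (i0 : nat) :
  0 < beta -> 0 < r < 1 ->
  (forall i s, s \in net i -> K s) ->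
  (forall i p, K p -> exists2 s, s \in net i & `|p - s| <= 2^-1 ^+ i) ->
  (forall p q, K p -> K q -> `|X p - X q| <= M * `|p - q| `^ beta) ->
  (forall i s t, (i0 <= i)%N -> (s, t) \in net_pairs net i ->
    `|X s - X t| <= r ^+ i) ->
  forall p q, K p -> K q -> `|p - q| < 2^-1 ^+ i0 ->
    `|X p - X q| <= r ^+ i0 * (1 + 2 / (1 - r)).
Proof.
move=> beta0 /andP[r0 r1] netK cover X_holder X_pairs p q Kp Kq pq.
have half0 : 0 < 2^-1 :> R by rewrite invr_gt0.
pose near_pt z i := xget p [set s | s \in net i /\ `|z - s| <= 2^-1 ^+ i].
have near_ptP z i : K z -> near_pt z i \in net i /\ `|z - near_pt z i| <= 2^-1 ^+ i.
  move=> Kz; rewrite /near_pt; case: xgetP => [s _ //|H].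
  by have [s sn zs] := cover i z Kz; exfalso; apply: (H s).
have step z i : K z -> (i0 <= i)%N -> `|X (near_pt z i) - X (near_pt z i.+1)| <= r ^+ i.
  move=> Kz ii0; have [n1 d1] := near_ptP z i Kz; have [n2 d2] := near_ptP z i.+1 Kz.
  apply: X_pairs => //; apply/net_pairsP; split => //.
    by rewrite mem_cat n2 orbT.
  rewrite -(subrKA z) (le_trans (ler_normD _ _))// distrC.
  have : 0 < 2^-1 ^+ i :> R by rewrite exprn_gt0.
  by move: d1 d2; rewrite exprS; lra.
have chain z N : K z ->
    `|X (near_pt z i0) - X (near_pt z (i0 + N)%N)| <= r ^+ i0 * (1 - r ^+ N) / (1 - r).
  move=> Kz; elim: N => [|N ih]; first by rewrite addn0 subrr normr0 expr0 subrr mulr0 mul0r.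
  rewrite -(subrKA (X (near_pt z (i0 + N)%N))) (le_trans (ler_normD _ _))//.
  apply: (le_trans (lerD ih _)); first by rewrite addnS; apply: step => //; rewrite leq_addr.
  rewrite exprD le_eqVlt; apply/orP; left; apply/eqP.
  by rewrite exprS; field; rewrite subr_eq0 gt_eqF.
have h1 : 2^-1 `^ beta < 1 :> R.
  have := @gt0_ltr_powR R beta beta0 2^-1 1; rewrite powR1; apply.
  - by rewrite nnegrE ltW.
  - by rewrite nnegrE ler01.
  - by rewrite invf_lt1// ltr1n.
have cvg0 : geometric `|M| (2^-1 `^ beta) n @[n --> \oo] --> (0 : R).
  by apply: cvg_geometric; rewrite ger0_norm ?powR_ge0.
have X_near z : K z -> `|X z - X (near_pt z i0)| <= r ^+ i0 / (1 - r).
  (* The chain is cut at a level [i0 + N] so fine that the Hölder bound makes the remaining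
     increment at most [e]. *)
  move=> Kz; apply/ler_addgt0Pl => e e0.
  have [N HN] : exists N : nat, `|M| * (2^-1 `^ beta) ^+ (i0 + N) <= e.
    move/cvgr0Pnorm_le : cvg0 => /(_ e e0)[N _ /(_ (i0 + N)%N)/= H].
    exists N; apply: le_trans (H _); first exact: ler_norm.
    exact: leq_addl.
  have [n1 d1] := near_ptP z (i0 + N)%N Kz.
  rewrite -(subrKA (X (near_pt z (i0 + N)%N))) (le_trans (ler_normD _ _))//.
  apply: lerD.
    apply: le_trans (X_holder _ _ Kz (netK _ _ n1)) _; apply: le_trans HN.
    apply: (@le_trans _ _ (`|M| * `|z - near_pt z (i0 + N)%N| `^ beta)).
      by rewrite ler_wpM2r ?powR_ge0 ?ler_norm.
    rewrite ler_wpM2l// -powR_mulrn ?powR_ge0// powRAC powR_mulrn ?(ltW half0)//.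
    by apply: ge0_ler_powR; rewrite ?nnegrE ?exprn_ge0// ltW.
  rewrite distrC (le_trans (chain z N Kz))// ler_wpM2r ?invr_ge0 ?subr_ge0 ?(ltW r1)//.
  by rewrite ler_piMr ?exprn_ge0 ?(ltW r0)// gerBl exprn_ge0// ltW.
have [n1 d1] := near_ptP p i0 Kp; have [n2 d2] := near_ptP q i0 Kq.
have mid : `|X (near_pt p i0) - X (near_pt q i0)| <= r ^+ i0.
  apply: X_pairs => //; apply/net_pairsP; split => //; first by rewrite mem_cat n2.
  have := ler_distD p (near_pt p i0) (near_pt q i0).
  have := ler_distD q p (near_pt q i0).
  have : 0 < 2^-1 ^+ i0 :> R by rewrite exprn_gt0.
  by move: d1 d2 pq; rewrite (distrC p (near_pt p i0)); lra.
have := X_near p Kp; have := X_near q Kq.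
have := ler_distD (X (near_pt p i0)) (X p) (X q).
have := ler_distD (X (near_pt q i0)) (X (near_pt p i0)) (X q).
have -> : r ^+ i0 * (1 + 2 / (1 - r)) = r ^+ i0 + r ^+ i0 / (1 - r) + r ^+ i0 / (1 - r).
  by ring.
by move: mid; rewrite (distrC (X q)); lra.
Qed.

(** * Exponential tails of i.i.d. sums *)

Section product_expectation.
Import HBNNSimple.
Local Open Scope ereal_scope.

(** Independence enters only through indicators of [W] tested against [g]. Linearity extends the
    factorisation to nonnegative simple functions, monotone convergence to [f]; as [c] is finite,
    multiplication by it commutes with the limit. *)
Lemma ge0_integral_indep_mul d dT (Omega : measurableType d) (T : measurableType dT)
    {R : realType} (P : {measure set Omega -> \bar R}) (W : Omega -> T)
    (g : Omega -> R) (c : R) (f : T -> R) :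
  measurable_fun setT W -> measurable_fun setT g -> (forall w, 0 <= g w)%R ->
  (0 <= c)%R -> measurable_fun setT f -> (forall z, 0 <= f z)%R ->
  (forall B, measurable B ->
    \int[P]_w (\1_B (W w) * g w)%:E = c%:E * P (W @^-1` B)) ->
  \int[P]_w (f (W w) * g w)%:E = c%:E * \int[P]_w (f (W w))%:E.
Proof.
move=> mW mg g0 c0 mf f0 H.
have mEf : measurable_fun setT (EFin \o f) by exact/measurable_EFinP.
pose f_ := nnsfun_approx measurableT mEf.
have f_nd z m n : (m <= n)%N -> (f_ m z <= f_ n z)%R.
  by move=> mn; exact/lefP/nd_nnsfun_approx.
have f_cvg z : (f_ n z)%:E @[n --> \oo] --> (f z)%:E.
  by apply: (cvg_nnsfun_approx measurableT mEf) => // *; rewrite lee_fin.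
have mfW n : measurable_fun setT (fun w => f_ n (W w)) by exact: measurableT_comp.
have mWB B : measurable B -> measurable (W @^-1` B).
  by move=> mB; rewrite -[X in measurable X]setTI; exact: mW.
have mpre n k : measurable (f_ n @^-1` [set k]) by [].
pose F n (k : R) w := (k * \1_(f_ n @^-1` [set k]) (W w))%:E.
have F0 n k w : 0 <= F n k w.
  by rewrite /F EFinM; exact: nnfun_muleindic_ge0.
have m1 n k : measurable_fun setT (fun w => \1_(f_ n @^-1` [set k]) (W w) : R).
  by apply: (measurableT_comp _ mW); exact: measurable_indic.
have mF n k : measurable_fun setT (F n k).
  by apply/measurable_EFinP/measurable_funM.
have FE n w : (f_ n (W w))%:E = \sum_(k \in range (f_ n)) F n k w.
  by rewrite fimfunE fsumEFin.
(* The finite sums are indexed by real levels without a sign; a negative level contributes an empty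
   set. *)
have k_cases n (k : R) : (0 <= k)%R \/ f_ n @^-1` [set k] = set0.
  by case: (leP 0%R k) => [|/preimage_nnfun0 ->]; [left|right].
have intF n k : \int[P]_w F n k w = k%:E * P (W @^-1` (f_ n @^-1` [set k])).
  case: (k_cases n k) => [k0|E]; last first.
    rewrite /F E preimage_set0 measure0 mule0 integral0_eq// => w _.
    by rewrite indic0 mulr0.
  rewrite /F; under eq_integral do rewrite EFinM.
  rewrite ge0_integralZl//; last exact/measurable_EFinP.
  congr (_ * _); have := @integral_indic _ _ _ P setT measurableT _ (mWB _ (mpre n k)).
  by rewrite setIT.
have intFg n k : \int[P]_w (F n k w * (g w)%:E) = c%:E * \int[P]_w F n k w.
  rewrite intF; case: (k_cases n k) => [k0|E]; last first.
    rewrite /F E preimage_set0 measure0 !mule0 integral0_eq// => w _.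
    by rewrite indic0 mulr0 mul0e.
  rewrite muleCA -H// -ge0_integralZl//; last 2 first.
  - by apply/measurable_EFinP/measurable_funM.
  - by move=> w _; rewrite lee_fin mulr_ge0.
  by apply: eq_integral => w _; rewrite /F -!EFinM mulrA.
have step n : \int[P]_w (f_ n (W w) * g w)%:E = c%:E * \int[P]_w (f_ n (W w))%:E.
  transitivity (\int[P]_w \sum_(k \in range (f_ n)) (F n k w * (g w)%:E)).
    by apply: eq_integral => w _; rewrite EFinM FE ge0_mule_fsuml.
  rewrite ge0_integral_fsum//; last 2 first.
  - by move=> k; apply: emeasurable_funM => //; exact/measurable_EFinP.
  - by move=> k w _; rewrite mule_ge0// lee_fin.
  rewrite (eq_fsbigr (fun k => c%:E * \int[P]_w F n k w))//.
  rewrite -ge0_mule_fsumr; last by move=> k; exact: integral_ge0.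
  rewrite -ge0_integral_fsum//.
  by congr (_ * _); apply: eq_integral => w _; rewrite -FE.
have lim1 : \int[P]_w (f_ n (W w) * g w)%:E @[n --> \oo] --> \int[P]_w (f (W w) * g w)%:E.
  rewrite (_ : \int[P]_w (f (W w) * g w)%:E =
    \int[P]_w limn (fun n => (f_ n (W w) * g w)%:E)); last first.
    apply: eq_integral => w _; apply/esym/cvg_lim => //.
    under eq_fun do rewrite EFinM.
    by rewrite EFinM; apply: cvgeZr.
  apply: cvg_monotone_convergence => //.
  - by move=> n; apply/measurable_EFinP/measurable_funM.
  - by move=> n w _; rewrite lee_fin mulr_ge0.
  - by move=> w _ m n mn; rewrite lee_fin ler_wpM2r// f_nd.
have lim2 : c%:E * \int[P]_w (f_ n (W w))%:E @[n --> \oo] --> c%:E * \int[P]_w (f (W w))%:E.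
  apply: cvgeZl => //.
  rewrite (_ : \int[P]_w (f (W w))%:E =
    \int[P]_w limn (fun n => (f_ n (W w))%:E)); last first.
    by apply: eq_integral => w _; apply/esym/cvg_lim.
  apply: cvg_monotone_convergence => //.
  - by move=> n; apply/measurable_EFinP.
  - by move=> n w _; rewrite lee_fin.
  - by move=> w _ m n mn; rewrite lee_fin f_nd.
move: lim1; under eq_fun do rewrite step.
by move=> lim1; exact: (cvg_unique _ lim1 lim2).
Qed.

End product_expectation.

Section iid_sequence.
Context {R : realType} {d : measure_display} {Omega : measurableType d}
  {P : probability Omega R} {dd : nat} {Z : nat -> Omega -> Rvec R dd}.
Hypothesis iidZ : iid P Z.
Local Open Scope ereal_scope.

Lemma iid_measurable n : measurable_fun setT (Z n).
Proof. by case: iidZ. Qed.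

Lemma iid_measurable_preimage n B : measurable B -> measurable (Z n @^-1` B).
Proof.
by move=> mB; rewrite -[X in measurable X]setTI; exact: iid_measurable.
Qed.

Lemma iid_integral n (g : Rvec R dd -> \bar R) : measurable_fun setT g ->
  \int[P]_w g (Z n w) = \int[P]_w g (Z 0%N w).
Proof.
move=> mg.
have ge0 (h : Rvec R dd -> \bar R) : measurable_fun setT h -> (forall z, 0 <= h z) ->
    \int[P]_w h (Z n w) = \int[P]_w h (Z 0%N w).
  move=> mh h0.
  have push i := @ge0_integral_pushforward _ _ _ _ _ _ (iid_measurable i) P setT h measurableT mh
    (fun z _ => h0 z).
  have eqZ B : measurable B -> pushforward P (Z n) B = pushforward P (Z 0%N) B.
    by case: iidZ => _ [H _]; exact: H.
  transitivity (\int[pushforward P (Z n)]_z h z); first by rewrite push.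
  transitivity (\int[pushforward P (Z 0%N)]_z h z); last by rewrite push.
  pose nu i : {measure set (Rvec R dd) -> \bar R} :=
    measure_function_pushforward__canonical__measure_function_Measure P (iid_measurable i).
  by apply: (eq_measure_integral (nu 0%N) (m1 := nu n)) => B mB _; exact: eqZ.
rewrite integralE [RHS]integralE; congr (_ - _).
  under eq_integral do rewrite funeposE -(funeposE g).
  under [RHS]eq_integral do rewrite funeposE -(funeposE g).
  exact: (ge0 _ (measurable_funepos mg) (funepos_ge0 g)).
under eq_integral do rewrite funenegE -(funenegE g).
under [RHS]eq_integral do rewrite funenegE -(funenegE g).
exact: (ge0 _ (measurable_funeneg mg) (funeneg_ge0 g)).
Qed.

(** Independence is given for events, so factors are converted one at a time. To factor out
    [f (Z i)], it suffices to test [1_C (Z i)] against the other factors, which is the induction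
    hypothesis with [i] moved from [s1] to [s2]. Hence the mixed product of values and indicators,
    general in [s2] and [B]. *)
Lemma iid_product_indic (f : Rvec R dd -> R) (a : R) (s1 s2 : seq nat)
    (B : nat -> set (Rvec R dd)) :
  measurable_fun setT f -> (forall z, 0 <= f z)%R ->
  \int[P]_w (f (Z 0%N w))%:E = a%:E ->
  uniq (s1 ++ s2) -> (forall i, measurable (B i)) ->
  \int[P]_w ((\prod_(i <- s1) f (Z i w)) * \prod_(i <- s2) \1_(B i) (Z i w))%:E =
  (a ^+ size s1)%:E * \prod_(i <- s2) P (Z i @^-1` B i).
Proof.
move=> mf f0 Ef; elim: s1 s2 B => [|i s1 ih] s2 B /=.
  move=> us2 mB; rewrite expr0 mul1e.
  case: (iidZ) => _ [_ <-//].
  under eq_integral do rewrite big_nil mul1r.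
  have -> : (fun w => (\prod_(i <- s2) \1_(B i) (Z i w))%:E) =
      (fun w => (\1_(\big[setI/setT]_(i <- s2) (Z i @^-1` B i)) w)%:E : \bar R).
    apply/funext => w; congr (_%:E); elim: (s2) => [|j s ihs].
      by rewrite !big_nil indicT.
    by rewrite !big_cons ihs indicI.
  rewrite integral_indic// ?setIT//.
  by apply: bigsetI_measurable => j _; exact: iid_measurable_preimage.
move=> /andP[is12 us12] mB.
have mfZ j : measurable_fun setT (fun w => f (Z j w)).
  exact: measurableT_comp (iid_measurable j).
have m1Z j C : measurable C -> measurable_fun setT (fun w => \1_C (Z j w) : R).
  move=> mC; apply: (measurableT_comp _ (iid_measurable j)).
  exact: measurable_indic.
pose g w := (\prod_(i <- s1) f (Z i w) * \prod_(i <- s2) \1_(B i) (Z i w))%R.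
pose c := (a ^+ size s1 * \prod_(i <- s2) fine (P (Z i @^-1` B i)))%R.
have prodE : \prod_(i <- s2) P (Z i @^-1` B i) =
    (\prod_(i <- s2) fine (P (Z i @^-1` B i)))%:E.
  rewrite -prodEFin; apply: eq_bigr => j _; rewrite fineK//.
  exact/fin_num_measure/iid_measurable_preimage.
have a0 : (0 <= a)%R by rewrite -lee_fin -Ef integral_ge0// => w _; rewrite lee_fin.
transitivity (\int[P]_w (f (Z i w) * g w)%:E).
  by apply: eq_integral => w _; rewrite big_cons /g mulrA.
rewrite (@ge0_integral_indep_mul _ _ _ _ _ P (Z i) g c)//.
- rewrite (iid_integral i (g := EFin \o f)); last exact/measurable_EFinP.
  rewrite Ef prodE -!EFinM; congr (_%:E).
  by rewrite /c exprS mulrC mulrA.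
- exact: iid_measurable.
- by apply: measurable_funM; apply: measurable_prod => j _; auto.
- by move=> w; apply: mulr_ge0; apply: prodr_ge0.
- rewrite /c mulr_ge0 ?exprn_ge0// prodr_ge0// => j _.
  by rewrite fine_ge0.
move=> C mC.
(* Since [i] does not occur in [s2], changing the set at [i] leaves the other factors intact. *)
pose B' j := if j == i then C else B j.
have := ih (i :: s2) B'; rewrite big_cons /B' eqxx.
have s2i j : j \in s2 -> (j == i) = false.
  by move=> js2; apply/negP => /eqP ji; move: is12; rewrite mem_cat -ji js2 orbT.
have -> : \prod_(j <- s2) P (Z j @^-1` (if j == i then C else B j)) =
    \prod_(j <- s2) P (Z j @^-1` B j).
  by apply: eq_big_seq => j /s2i ->.
rewrite prodE => H.
rewrite /c EFinM -muleA (muleC (\prod_(_ <- _) _)%:E) -H.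
- apply: eq_integral => w _; congr (_%:E).
  rewrite big_cons eqxx /g mulrCA; congr (_ * (_ * _))%R.
  by apply: eq_big_seq => j /s2i ->.
- by rewrite (perm_uniq (permEl (perm_catCA s1 [:: i] s2)))/= is12.
- by move=> j; case: ifP.
Qed.

Lemma iid_product (f : Rvec R dd -> R) (a : R) (n : nat) :
  measurable_fun setT f -> (forall z, 0 <= f z)%R ->
  \int[P]_w (f (Z 0%N w))%:E = a%:E ->
  \int[P]_w (\prod_(i < n) f (Z i w))%:E = (a ^+ n)%:E.
Proof.
move=> mf f0 Ef.
have := @iid_product_indic f a (index_iota 0 n) [::] (fun=> setT) mf f0 Ef.
rewrite cats0 iota_uniq size_iota subn0 big_nil mule1 => <-//.
by apply: eq_integral => w _; rewrite big_nil mulr1 big_mkord.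
Qed.

End iid_sequence.

Lemma measurable_ge_set d (Omega : measurableType d) {R : realType}
    (f : Omega -> R) (t : R) :
  measurable_fun setT f -> measurable [set w | t <= f w].
Proof.
move=> mf; rewrite -[X in measurable X]setTI -[X in _ `&` X]/(f @^-1` [set x | t <= x]).
by rewrite -set_itvcy; apply: mf.
Qed.

Lemma measurable_gt_set d (Omega : measurableType d) {R : realType}
    (f : Omega -> R) (t : R) :
  measurable_fun setT f -> measurable [set w | t < f w].
Proof.
move=> mf; rewrite -[X in measurable X]setTI -[X in _ `&` X]/(f @^-1` [set x | t < x]).
by rewrite -set_itvoy; apply: mf.
Qed.

Lemma bounded_integrable d (Omega : measurableType d) {R : realType}
    (P : probability Omega R) (X : Omega -> R) (M : R) :
  measurable_fun setT X -> (forall w, `|X w| <= M) ->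
  P.-integrable setT (EFin \o X).
Proof.
move=> mX XM; apply: measurable_bounded_integrable => //.
  by apply: le_lt_trans (probability_le1 P measurableT) _; rewrite ltry.
by exists M; split; [exact: num_real | move=> y My w _; exact: le_trans (ltW My)].
Qed.

(** Inverting [1 - y <= expR (- y)] gives [expR y <= (1 - y)^-1]; the quadratic dominates this
    because its product with [1 - y] exceeds 1 by [y^2 (1 - 2 y)]. *)
Lemma expR_le_quadratic {R : realType} (y : R) : y <= 2^-1 ->
  expR y <= 1 + y + 2 * y ^+ 2.
Proof.
move=> y2; have y1 : 0 < 1 - y by lra.
rewrite -[y in expR y]opprK expRN (@le_trans _ _ (1 - y)^-1)//.
  by rewrite lef_pV2 ?posrE ?expR_gt0// expR_ge1Dx.
rewrite -[leLHS]mul1r ler_pdivrMr// -subr_ge0.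
have -> : (1 + y + 2 * y ^+ 2) * (1 - y) - 1 = y ^+ 2 * (1 - 2 * y) by ring.
by rewrite mulr_ge0 ?sqr_ge0//; lra.
Qed.

(** Centering removes the linear term of the quadratic bound, which leaves
    [1 + 2 v <= expR (2 * v)]. *)
Lemma expR_mean_le d (Omega : measurableType d) {R : realType}
    (P : probability Omega R) (X : Omega -> R) (v : R) :
  measurable_fun setT X -> (forall w, `|X w| <= 2^-1) ->
  \int[P]_w X w = 0 -> \int[P]_w X w ^+ 2 <= v ->
  \int[P]_w expR (X w) <= expR (2 * v).
Proof.
move=> mX X2 EX EX2.
have iX := bounded_integrable P mX X2.
have mX2 : measurable_fun setT (fun w => X w ^+ 2) by exact: measurable_funX.
have iX2 : P.-integrable setT (EFin \o (fun w => X w ^+ 2)).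
  by apply: (@bounded_integrable _ _ _ P _ (2^-1 ^+ 2)) => // w; rewrite normrX lerXn2r// nnegrE.
have i1 : P.-integrable setT (EFin \o (fun=> 1 : R)).
  by apply: (@bounded_integrable _ _ _ P _ 1) => // w; rewrite normr1.
have iX22 : P.-integrable setT (EFin \o (fun w => 2 * X w ^+ 2)).
  by apply: (integrableZl _ 2 iX2).
have i1X : P.-integrable setT (EFin \o (fun w => 1 + X w)).
  exact: (integrableD _ i1 iX).
have le_int : \int[P]_w expR (X w) <= \int[P]_w (1 + X w + 2 * X w ^+ 2).
  apply: le_Rintegral => //.
  - apply: (@bounded_integrable _ _ _ P _ (expR 2^-1)).
      exact: measurableT_comp.
    move=> w; rewrite ger0_norm ?expR_ge0// ler_expR (le_trans (ler_norm _))//.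
  - exact: (integrableD _ i1X iX22).
  - move=> w _; apply: expR_le_quadratic.
    exact: le_trans (ler_norm _) (X2 w).
apply: le_trans le_int _.
rewrite RintegralD// RintegralD// RintegralZl// EX addr0 Rintegral_cst//.
have PT : fine (P setT) = 1 by have /(congr1 fine) := probability_setT P.
rewrite PT mulr1 (le_trans _ (expR_ge1Dx _))// lerD2l.
by rewrite ler_wpM2l.
Qed.

Section exponential_tail.
Context {R : realType} {d : measure_display} {Omega : measurableType d}
  {P : probability Omega R} {dd : nat} {Z : nat -> Omega -> Rvec R dd}.
Hypothesis iidZ : iid P Z.

Lemma measurable_iid_sum (y : Rvec R dd -> R) n : measurable_fun setT y ->
  measurable_fun setT (fun w => \sum_(i < n) y (Z i w)).
Proof.
move=> my; apply: measurable_sum => i.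
exact: measurableT_comp (iid_measurable iidZ i).
Qed.

(** Chernoff's bound with parameter 1: the scale is already built into [y], and nothing is
    optimised. The mean of [expR] of the sum factorises into the n-th power of a single mean. *)
Lemma iid_exp_tail_one_sided (y : Rvec R dd -> R) (v t : R) (n : nat) :
  measurable_fun setT y -> (forall z, `|y z| <= 2^-1) ->
  \int[P]_w y (Z 0%N w) = 0 -> \int[P]_w y (Z 0%N w) ^+ 2 <= v ->
  (P [set w | (t <= \sum_(i < n) y (Z i w))%R] <= (expR (2 * v * n%:R - t))%:E)%E.
Proof.
move=> my y2 Ey Ey2; set S := fun w => \sum_(i < n) y (Z i w).
have mS : measurable_fun setT S by exact: measurable_iid_sum.
have mexp : measurable_fun setT (fun z => expR (y z)) by exact: measurableT_comp.
have mZ0 := iid_measurable iidZ 0.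
have Eexp : (\int[P]_w (expR (y (Z 0%N w)))%:E = (\int[P]_w expR (y (Z 0%N w)))%:E)%E.
  rewrite /Rintegral fineK//; apply: integrable_fin_num => //.
  apply: (@bounded_integrable _ _ _ P _ (expR 2^-1)).
    exact: (measurableT_comp mexp mZ0).
  move=> w; rewrite ger0_norm ?expR_ge0// ler_expR (le_trans (ler_norm _))//.
have := iid_product iidZ n mexp (fun z => expR_ge0 _) Eexp.
under eq_integral do rewrite -expR_sum -/(S _).
have mean_le := expR_mean_le (measurableT_comp my mZ0) (fun w => y2 _) Ey Ey2.
move=> ES.
have {ES} ES : (\int[P]_w (expR (S w))%:E <= (expR (2 * v * n%:R))%:E)%E.
  rewrite ES lee_fin mulrC expRM_natl lerXn2r ?nnegrE ?expR_ge0//.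
  by apply: Rintegral_ge0 => w _; exact: expR_ge0.
(* Markov's inequality for [expR (S w)] at level [expR t]. *)
have := @le_integral_comp_abse _ _ _ P setT measurableT (fun w => (expR (S w))%:E)
  (expR t) id (@measurable_id _ _ _) (fun r r0 => r0) (fun x y _ _ xy => xy).
rewrite expR_gt0 setTI => /(_ _ isT) H.
rewrite expRB mulrC EFinM -(lee_pmul2l (_ : (expR t)%:E \is a fin_num)) ?lte_fin ?expR_gt0//.
rewrite muleA -EFinM divff ?mul1r ?gt_eqF ?expR_gt0//.
apply: le_trans ES; apply: le_trans.
  apply: le_trans (H _); last exact/measurable_EFinP/measurableT_comp.
  rewrite le_eqVlt; apply/orP; left; apply/eqP; congr (_ * P _)%E.
  apply/seteqP; split => w /=; rewrite lee_fin ger0_norm ?expR_ge0// ler_expR//.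
by rewrite le_eqVlt; apply/orP; left; apply/eqP/eq_integral => w _; rewrite /= ger0_norm ?expR_ge0.
Qed.

Lemma iid_exp_tail (y : Rvec R dd -> R) (v t : R) (n : nat) :
  measurable_fun setT y -> (forall z, `|y z| <= 2^-1) ->
  \int[P]_w y (Z 0%N w) = 0 -> \int[P]_w y (Z 0%N w) ^+ 2 <= v ->
  (P [set w | (t < `|\sum_(i < n) y (Z i w)|)%R] <=
    (2 * expR (2 * v * n%:R - t))%:E)%E.
Proof.
move=> my y2 Ey Ey2.
have myZ : measurable_fun setT (fun w => y (Z 0%N w)).
  exact: (measurableT_comp my (iid_measurable iidZ 0)).
have iy : P.-integrable setT (EFin \o (fun w => y (Z 0%N w))).
  exact: (bounded_integrable P myZ (fun w => y2 _)).
have mS := measurable_iid_sum n my.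
have mSN := measurable_iid_sum n (measurable_funN my).
have tailp := iid_exp_tail_one_sided t n my y2 Ey Ey2.
have := @iid_exp_tail_one_sided (fun z => - y z) v t n (measurable_funN my).
have -> : \int[P]_w - y (Z 0%N w) = 0.
  by under eq_Rintegral do rewrite -mulN1r; rewrite RintegralZl// Ey mulr0.
under eq_Rintegral do rewrite sqrrN.
move=> /(_ _ erefl Ey2) tailn.
rewrite mulrDl mul1r EFinD.
apply: le_trans (leeD tailp (tailn _)); last by move=> z; rewrite normrN.
apply: le_trans (measureU2 P (measurable_ge_set t mS) (measurable_ge_set t mSN)).
apply: le_measure; rewrite ?inE.
- by apply: measurable_gt_set; exact: measurableT_comp.
- by apply: measurableU; exact: measurable_ge_set.
- move=> w /=; rewrite sumrN; case: (leP 0 (\sum_(i < n) y (Z i w))) => [s0|s0].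
    by rewrite ger0_norm// => /ltW; left.
  by rewrite ltr0_norm// => /ltW; right.
Qed.

(* Bernstein's inequality at the scale [D sqrt n], where it needs nothing
   more than the second moment. *)
Lemma iid_centered_tail (g : Rvec R dd -> R) (D s t : R) (n : nat) :
  (0 < n)%N -> 0 < D -> measurable_fun setT g ->
  (forall z, `|g z| <= D * Num.sqrt n%:R) ->
  \int[P]_w g (Z 0%N w) ^+ 2 <= D ^+ 2 * s ->
  (P [set w | (4 * D * Num.sqrt n%:R * t <
      `|\sum_(i < n) (g (Z i w) - \int[P]_v g (Z 0%N v))|)%R] <=
    (2 * expR (s - t))%:E)%E.
Proof.
move=> n0 D0 mg gD g2s; set e := \int[P]_v g (Z 0%N v).
set b := D * Num.sqrt n%:R.
have b0 : 0 < b by rewrite mulr_gt0// sqrtr_gt0 ltr0n.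
have bsq : b ^+ 2 = D ^+ 2 * n%:R by rewrite exprMn sqr_sqrtr.
have mgZ : measurable_fun setT (fun w => g (Z 0%N w)).
  exact: (measurableT_comp mg (iid_measurable iidZ 0)).
have ig : P.-integrable setT (EFin \o (fun w => g (Z 0%N w))).
  exact: (bounded_integrable P mgZ (fun w => gD _)).
have PT : fine (P setT) = 1 by have /(congr1 fine) := probability_setT P.
have icst (k : R) : P.-integrable setT (EFin \o (fun=> k)).
  exact: (@bounded_integrable _ _ _ P _ `|k|).
have e_b : `|e| <= b.
  apply: le_trans (le_normr_Rintegral measurableT ig) _.
  rewrite -[leRHS]mulr1 -PT -Rintegral_cst//; apply: le_Rintegral => //.
  exact: (integrable_norm ig).
(* Both [g] and its mean [e] are bounded by [b], so [g - e] is bounded by [2 b], and division by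
   [4 b] gives the bound 1/2 required for the exponential tail. *)
pose y z := (g z - e) / (4 * b).
have b4 : 0 < 4 * b by rewrite mulr_gt0.
have my : measurable_fun setT y by apply: measurable_funM => //; exact: measurable_funB.
have y2 z : `|y z| <= 2^-1.
  rewrite /y normrM (gtr0_norm (_ : 0 < (4 * b)^-1)) ?invr_gt0// ler_pdivrMr//.
  by have := ler_normB (g z) e; have := gD z; rewrite -/b; lra.
have ige : P.-integrable setT (EFin \o (fun w => g (Z 0%N w) - e)).
  exact: (integrableB _ ig (icst e)).
have Ey : \int[P]_w y (Z 0%N w) = 0.
  by rewrite /y RintegralZr// RintegralB// Rintegral_cst// PT mulr1 subrr mul0r.
have n0R : 0 < n%:R :> R by rewrite ltr0n.
have s0 : 0 <= s.
  rewrite -(pmulr_rge0 _ (exprn_gt0 2 D0)); apply: le_trans g2s.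
  by apply: Rintegral_ge0 => w _; exact: sqr_ge0.
(* The variance is at most the second moment [D^2 s], and [b^2 = D^2 n]. The factor [n] then cancels
   in the exponent, which becomes [s / 8 - t], uniformly in [n]. *)
have Ey2 : \int[P]_w y (Z 0%N w) ^+ 2 <= s / (16 * n%:R).
  have -> : (fun w => y (Z 0%N w) ^+ 2) =
      (fun w => (16 * b ^+ 2)^-1 *
        (g (Z 0%N w) ^+ 2 + (- (2 * e) * g (Z 0%N w) + e ^+ 2))).
    by apply/funext => w; rewrite /y; field; rewrite gt_eqF.
  have mg2 : measurable_fun setT (fun w => g (Z 0%N w) ^+ 2) by exact: measurable_funX.
  have ig2 : P.-integrable setT (EFin \o (fun w => g (Z 0%N w) ^+ 2)).
    apply: (@bounded_integrable _ _ _ P _ (b ^+ 2)) => // w.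
    by rewrite normrX lerXn2r ?nnegrE ?(ltW b0)// gD.
  have ieg : P.-integrable setT (EFin \o (fun w => - (2 * e) * g (Z 0%N w))).
    exact: (integrableZl _ (- (2 * e)) ig).
  have iege : P.-integrable setT (EFin \o (fun w => - (2 * e) * g (Z 0%N w) + e ^+ 2)).
    exact: (integrableD _ ieg (icst _)).
  rewrite RintegralZl//; last exact: (integrableD _ ig2 iege).
  rewrite RintegralD// RintegralD// RintegralZl// Rintegral_cst// PT mulr1 -/e.
  have -> : s / (16 * n%:R) = (16 * b ^+ 2)^-1 * (D ^+ 2 * s).
    by rewrite bsq; field; rewrite !gt_eqF.
  apply: ler_wpM2l; first by rewrite invr_ge0 mulr_ge0 ?sqr_ge0.
  by have := sqr_ge0 e; lra.
have := iid_exp_tail t n my y2 Ey Ey2.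
have -> : [set w | t < `|\sum_(i < n) y (Z i w)|] =
    [set w | 4 * D * Num.sqrt n%:R * t < `|\sum_(i < n) (g (Z i w) - e)|].
  apply/seteqP; split => w /=; rewrite /y -mulr_suml normrM
    (gtr0_norm (_ : 0 < (4 * b)^-1)) ?invr_gt0// ltr_pdivlMr// /b;
  by rewrite mulrA (mulrC t).
move/le_trans; apply; rewrite lee_fin ler_wpM2l// ler_expR lerD2r.
have -> : 2 * (s / (16 * n%:R)) * n%:R = s / 8 by field; rewrite gt_eqF.
by lra.
Qed.

End exponential_tail.

(** * The truncated empirical process *)

Lemma measure_big_setU_le d (Omega : measurableType d) {R : realType}
    (P : {measure set Omega -> \bar R}) (I : eqType) (l : seq I)
    (F : I -> set Omega) (c : R) (N : nat) :
  (forall i, i \in l -> measurable (F i)) ->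
  (forall i, i \in l -> (P (F i) <= c%:E)%E) -> 0 <= c -> (size l <= N)%N ->
  (P (\big[setU/set0]_(i <- l) F i) <= (N%:R * c)%:E)%E.
Proof.
move=> mF Fc c0 lN; apply: (@le_trans _ _ ((size l)%:R * c)%:E); last first.
  by rewrite lee_fin ler_wpM2r// ler_nat.
elim: l mF Fc {lN} => [|i l ih] mF Fc; first by rewrite big_nil measure0 mul0r.
have ml j : j \in l -> measurable (F j) by move=> jl; apply: mF; rewrite in_cons jl orbT.
rewrite big_cons/= -natr1 addrC mulrDl mul1r EFinD.
apply: le_trans (measureU2 P (mF _ (mem_head _ _)) _) _.
  rewrite big_seq; apply: bigsetU_measurable => j jl; exact: ml.
apply: leeD; first by rewrite Fc ?mem_head.
by apply: ih => // j jl; rewrite Fc// in_cons jl orbT.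
Qed.

(* The ratio [r] is chosen so that [r ^+ 2 = 2^-1 `^ beta]: the tail exponent
   then grows like [r ^- i] and beats the cardinality of the nets. *)
Lemma net_tail_geometric {R : realType} (beta s : R) (A B : nat) : 0 < beta ->
  exists2 M : R, 0 <= M & forall i,
    (A * B ^ i)%:R * (2 * expR (s - (2^-1 `^ (beta / 2)) ^+ i
                                    / (4 * (4 * 2^-1 ^+ i) `^ beta)))
    <= M * 2^-1 ^+ i.
Proof.
move=> beta0; set r := 2^-1 `^ (beta / 2).
have half0 : 0 < 2^-1 :> R by rewrite invr_gt0.
have r0 : 0 < r by rewrite powR_gt0.
have r1 : r < 1.
  have := @gt0_ltr_powR R (beta / 2) (divr_gt0 beta0 (ltr0n R 2)) 2^-1 1.
  rewrite powR1; apply.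
  - by rewrite nnegrE ltW.
  - by rewrite nnegrE ler01.
  - by rewrite invf_lt1// ltr1n.
have rr : 2^-1 `^ beta = r ^+ 2.
  by rewrite -powR_mulrn ?powR_ge0// -powRrM divfK.
pose c := 4 * 4 `^ beta : R.
have c0 : 0 < c by rewrite mulr_gt0// powR_gt0.
have scaleE i : r ^+ i / (4 * (4 * 2^-1 ^+ i) `^ beta) = (c * r ^+ i)^-1.
  rewrite powRM ?exprn_ge0 ?(ltW half0)//.
  rewrite -(powR_mulrn _ (ltW half0)) powRAC powR_mulrn ?powR_ge0// rr -exprM.
  rewrite mulnC exprM expr2 /c.
  by field; rewrite !gt_eqF ?exprn_gt0 ?powR_gt0.
(* The degree [q.+1] of the Taylor term kept from the exponential is chosen so that [r ^+ q.+1]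
   absorbs the growth factor [B] of the cardinality and leaves 1/2. *)
have [q Hq] : exists q : nat, B%:R * r ^+ q.+1 <= 2^-1.
  have : geometric B%:R r n @[n --> \oo] --> (0 : R).
    by apply: cvg_geometric; rewrite ger0_norm ?(ltW r0).
  move/cvgr0Pnorm_le => /(_ 2^-1 half0)[N _ /(_ N.+1 (leqnSn N))/= H].
  by exists N; exact: le_trans (ler_norm _) H.
pose M := A%:R * (2 * expR s) * (q.+1`!%:R * c ^+ q.+1).
have M0 : 0 <= M by rewrite !mulr_ge0 ?expR_ge0 ?exprn_ge0// ltW.
exists M => // i; rewrite scaleE expRD expRN.
have ci0 : 0 < c * r ^+ i by rewrite mulr_gt0 ?exprn_gt0.
have fact0 : 0 < q.+1`!%:R :> R by rewrite ltr0n fact_gt0.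
have exp_le : (expR (c * r ^+ i)^-1)^-1 <= q.+1`!%:R * (c * r ^+ i) ^+ q.+1.
  rewrite -[leRHS]invrK lef_pV2 ?posrE ?expR_gt0 ?invr_gt0 ?mulr_gt0 ?exprn_gt0//.
  have := @expR_ge1Dxn R (c * r ^+ i)^-1 q (ltW _); rewrite invr_gt0 => /(_ ci0).
  by apply: le_trans; rewrite invfM exprVn mulrC lerDr.
apply: (@le_trans _ _ (M * (B%:R * r ^+ q.+1) ^+ i)); last first.
  rewrite ler_wpM2l// lerXn2r ?nnegrE ?mulr_ge0 ?exprn_ge0 ?(ltW r0) ?(ltW half0)//.
apply: (@le_trans _ _ ((A * B ^ i)%:R * (2 * (expR s *
    (q.+1`!%:R * (c * r ^+ i) ^+ q.+1))))).
  by rewrite !ler_wpM2l ?expR_ge0.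
rewrite natrM natrX /M !exprMn -!exprM (mulnC i) le_eqVlt.
by apply/orP; left; apply/eqP; ring.
Qed.

Section holder_class.
Context {R : realType} {d : measure_display} {Omega : measurableType d}
  {P : probability Omega R} {dd : nat} {Z : nat -> Omega -> Rvec R dd}.
Hypothesis iidZ : iid P Z.
Context {V : normedModType R} {K : set V} {h : V -> Rvec R dd -> R}
  {C : Rvec R dd -> R} {beta : R}.
Hypotheses (beta_gt0 : 0 < beta) (C_gt0 : forall z, 0 < C z)
  (mC : measurable_fun setT C)
  (iC2 : P.-integrable setT (EFin \o (fun w => C (Z 0%N w) ^+ 2)))
  (mh : forall p, K p -> measurable_fun setT (h p))
  (ih : forall p, K p -> P.-integrable setT (EFin \o (fun w => h p (Z 0%N w))))
  (h_holder : forall z p q, K p -> K q -> `|h p z - h q z| <= C z * `|p - q| `^ beta).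

(** The cut set is read off from [C], never from [f], so truncation is linear in [f] and commutes
    with taking increments. *)
Definition trunc (f : Rvec R dd -> R) (n : nat) (z : Rvec R dd) : R :=
  f z * \1_[set z | C z <= Num.sqrt n%:R] z.

Definition trunc_process (n : nat) (p : V) (w : Omega) : R :=
  (Num.sqrt n%:R)^-1 *
  \sum_(i < n) (trunc (h p) n (Z i w) - \int[P]_v trunc (h p) n (Z 0%N v)).

Lemma truncE_le f n z : C z <= Num.sqrt n%:R -> trunc f n z = f z.
Proof. by move=> Cz; rewrite /trunc indicE mem_set// mulr1. Qed.

Lemma truncE_gt f n z : Num.sqrt n%:R < C z -> trunc f n z = 0.
Proof. by move=> Cz; rewrite /trunc indicE memNset ?mulr0//= leNgt Cz. Qed.

Lemma measurable_trunc f n : measurable_fun setT f -> measurable_fun setT (trunc f n).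
Proof.
move=> mf; apply: measurable_funM => //; apply: measurable_indic.
rewrite -[X in measurable X]setTI -[X in _ `&` X]/(C @^-1` [set x | x <= Num.sqrt n%:R]).
by rewrite -set_itvNyc; apply: mC.
Qed.

Lemma normr_trunc_le f n z : `|trunc f n z| <= `|f z|.
Proof.
case: (leP (C z) (Num.sqrt n%:R)) => Cz; first by rewrite truncE_le.
by rewrite truncE_gt// normr0.
Qed.

Lemma integrable_trunc f n : measurable_fun setT f ->
  P.-integrable setT (EFin \o (fun w => f (Z 0%N w))) ->
  P.-integrable setT (EFin \o (fun w => trunc f n (Z 0%N w))).
Proof.
move=> mf; apply: le_integrable => //.
  apply/measurable_EFinP.
  exact: (measurableT_comp (measurable_trunc n mf) (iid_measurable iidZ 0)).
by move=> w _; rewrite lee_fin normr_trunc_le.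
Qed.

Lemma trunc_process_sub n p q w : K p -> K q ->
  trunc_process n p w - trunc_process n q w = (Num.sqrt n%:R)^-1 *
  \sum_(i < n) (trunc (fun z => h p z - h q z) n (Z i w)
    - \int[P]_v trunc (fun z => h p z - h q z) n (Z 0%N v)).
Proof.
move=> Kp Kq; rewrite /trunc_process -mulrBr -sumrB; congr (_ * _).
apply: eq_bigr => i _; have subE z : trunc (fun z => h p z - h q z) n z =
    trunc (h p) n z - trunc (h q) n z by rewrite /trunc mulrBl.
under [X in _ = _ - X]eq_Rintegral do rewrite subE.
rewrite subE RintegralB//; last 2 first.
- exact: integrable_trunc (mh Kp) (ih Kp).
- exact: integrable_trunc (mh Kq) (ih Kq).
by ring.
Qed.

Lemma trunc_increment_le n z p q (D : R) : K p -> K q -> `|p - q| `^ beta <= D ->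
  `|trunc (fun z => h p z - h q z) n z| <= D * Num.sqrt n%:R.
Proof.
move=> Kp Kq pqD; have D0 : 0 <= D by apply: le_trans pqD; exact: powR_ge0.
case: (leP (C z) (Num.sqrt n%:R)) => Cz; last first.
  by rewrite truncE_gt// normr0 mulr_ge0 ?sqrtr_ge0.
rewrite truncE_le// (le_trans (h_holder z Kp Kq))// mulrC.
by apply: ler_pM => //; rewrite ?powR_ge0// ltW.
Qed.

(** Each of the [n] centered terms is at most [2 sqrt n |p - q|^beta] before normalisation. The
    crude factor [2 n] is harmless: the bound serves only to close the chains at fixed [n]. *)
Lemma trunc_process_holder n w p q : K p -> K q ->
  `|trunc_process n p w - trunc_process n q w| <= (2 * n%:R) * `|p - q| `^ beta.
Proof.
move=> Kp Kq; rewrite trunc_process_sub// normrM.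
have [->|n0] := eqVneq n 0%N; first by rewrite big_ord0 normr0 !mulr0 mul0r.
have sn0 : 0 < Num.sqrt n%:R :> R by rewrite sqrtr_gt0 ltr0n lt0n.
have inc z := trunc_increment_le n z Kp Kq (lexx _).
set D := `|p - q| `^ beta in inc *.
rewrite gtr0_norm ?invr_gt0// mulrC ler_pdivrMr//.
apply: le_trans (ler_norm_sum _ _ _) _.
have -> : 2 * n%:R * D * Num.sqrt n%:R = \sum_(i < n) (2 * (D * Num.sqrt n%:R)).
  by rewrite sumr_const card_ord -[RHS]mulr_natl; ring.
apply: ler_sum => i _; rewrite (le_trans (ler_normB _ _))// mulrDl !mul1r lerD//.
have mg : measurable_fun setT (fun w => trunc (fun z => h p z - h q z) n (Z 0%N w)).
  apply: (measurableT_comp (measurable_trunc n _) (iid_measurable iidZ 0)).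
  by apply: measurable_funB; exact: mh.
have ig := bounded_integrable P mg (fun w => inc _).
apply: le_trans (le_normr_Rintegral measurableT ig) _.
have PT : fine (P setT) = 1 by have /(congr1 fine) := probability_setT P.
have cstE (c : R) : c = \int[P]_v c by rewrite Rintegral_cst// PT mulr1.
rewrite [leRHS]cstE; apply: le_Rintegral => //.
- exact: (integrable_norm ig).
- exact: (@bounded_integrable _ _ _ P (fun=> D * Num.sqrt n%:R) `|D * Num.sqrt n%:R|).
Qed.

(** A common radius [rho] gives all links of one level the same threshold and keeps the scale
    positive even when [p = q]. *)
Lemma trunc_process_tail n p q (rho t : R) : (0 < n)%N -> 0 < rho -> K p -> K q ->
  `|p - q| <= rho ->
  (P [set w | (4 * rho `^ beta * t < `|trunc_process n p w - trunc_process n q w|)%R]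
   <= (2 * expR (\int[P]_w C (Z 0%N w) ^+ 2 - t))%:E)%E.
Proof.
move=> n0 rho0 Kp Kq pqrho.
have D0 : 0 < rho `^ beta by rewrite powR_gt0.
have pqD : `|p - q| `^ beta <= rho `^ beta.
  by apply: ge0_ler_powR; rewrite ?nnegrE ?normr_ge0// ltW.
have mpq : measurable_fun setT (fun z => h p z - h q z).
  by apply: measurable_funB; exact: mh.
have mg := measurable_trunc n mpq.
have sn0 : 0 < Num.sqrt n%:R :> R by rewrite sqrtr_gt0 ltr0n.
have inc z := trunc_increment_le n z Kp Kq pqD.
have mgZ := measurableT_comp mg (iid_measurable iidZ 0).
have := iid_centered_tail iidZ t n0 D0 mg inc _.
have -> : [set w | 4 * rho `^ beta * t < `|trunc_process n p w - trunc_process n q w|] =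
    [set w | 4 * rho `^ beta * Num.sqrt n%:R * t <
      `|\sum_(i < n) (trunc (fun z => h p z - h q z) n (Z i w)
         - \int[P]_v trunc (fun z => h p z - h q z) n (Z 0%N v))|].
  apply/seteqP; split => w /=; rewrite trunc_process_sub// normrM;
  by rewrite gtr0_norm ?invr_gt0// (mulrC _^-1) ltr_pdivlMr// mulrAC.
apply; rewrite -RintegralZl//; apply: le_Rintegral => //.
- apply: (@bounded_integrable _ _ _ P _ ((rho `^ beta * Num.sqrt n%:R) ^+ 2)).
    exact: measurable_funX.
  by move=> w; rewrite normrX lerXn2r ?nnegrE ?inc// mulr_ge0// ltW.
- exact: (integrableZl _ (rho `^ beta ^+ 2) iC2).
- move=> w _; rewrite -exprMn -[leLHS]real_normK ?num_real// lerXn2r ?nnegrE//.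
    by rewrite mulr_ge0// ltW.
  apply: le_trans (normr_trunc_le _ _ _) _.
  apply: le_trans (h_holder _ Kp Kq) _.
  by rewrite mulrC ler_wpM2r// ltW.
Qed.

Lemma measurable_trunc_process n p : K p -> measurable_fun setT (trunc_process n p).
Proof.
move=> Kp; apply: measurable_funM => //; apply: measurable_sum => i.
apply: measurable_funB => //.
exact: (measurableT_comp (measurable_trunc n (mh Kp)) (iid_measurable iidZ i)).
Qed.

(** * Equicontinuity of the truncated process along nets *)

Context {net : nat -> seq V} {A B : nat}.
Hypotheses (netK : forall i s, s \in net i -> K s)
  (net_size : forall i, (size (net i) <= A * B ^ i)%N)
  (net_cover : forall i p, K p -> exists2 s, s \in net i & `|p - s| <= 2^-1 ^+ i).

Let r := 2^-1 `^ (beta / 2).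

Definition bad_increments n i : set Omega :=
  \big[setU/set0]_(st <- net_pairs net i)
    [set w | r ^+ i < `|trunc_process n st.1 w - trunc_process n st.2 w|].

Lemma net_pairsK i p q : (p, q) \in net_pairs net i -> K p /\ K q.
Proof.
move=> /net_pairsP[pn qn _]; split; first exact: netK pn.
by move: qn; rewrite mem_cat => /orP[] /netK.
Qed.

Lemma measurable_increment_gt n (c : R) p q : K p -> K q ->
  measurable [set w | c < `|trunc_process n p w - trunc_process n q w|].
Proof.
move=> Kp Kq; apply: measurable_gt_set; apply: measurableT_comp => //.
by apply: measurable_funB; exact: measurable_trunc_process.
Qed.

Lemma measurable_bad_increments n i : measurable (bad_increments n i).
Proof.
rewrite /bad_increments big_seq; apply: bigsetU_measurable => -[p q] /net_pairsK[Kp Kq].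
exact: measurable_increment_gt.
Qed.

(** A union bound over the links. The constant is uniform in [n] because the tails involve [n]
    nowhere. *)
Lemma bad_increments_le : exists2 M : R, 0 <= M & forall n i, (0 < n)%N ->
  (P (bad_increments n i) <= (M * 2^-1 ^+ i)%:E)%E.
Proof.
have [M M0 HM] := net_tail_geometric (\int[P]_w C (Z 0%N w) ^+ 2)
  (A ^ 2 * (1 + B)) (B ^ 2) beta_gt0.
exists M => // n i n0; have := HM i; rewrite -lee_fin; apply: le_trans.
apply: measure_big_setU_le.
- by move=> [p q] /net_pairsK[Kp Kq]; exact: measurable_increment_gt.
- move=> [p q] /[dup] pq /net_pairsP[_ _ d_pq]; have [Kp Kq] := net_pairsK pq.
  have rho0 : 0 < 4 * 2^-1 ^+ i :> R by rewrite mulr_gt0// exprn_gt0// invr_gt0.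
  (* This [t] makes the threshold [4 rho^beta t] equal to [r ^+ i] for [rho = 4 * 2^-1 ^+ i]. *)
  have := @trunc_process_tail n p q _
    (r ^+ i / (4 * (4 * 2^-1 ^+ i) `^ beta)) n0 rho0 Kp Kq d_pq.
  by rewrite mulrC divfK// gt_eqF// mulr_gt0// powR_gt0.
- by rewrite mulr_ge0 ?expR_ge0.
- exact: size_net_pairs.
Qed.

Lemma trunc_process_equicontinuous (eps eta : R) : 0 < eps -> 0 < eta ->
  exists2 delta : R, 0 < delta & forall n, (0 < n)%N ->
  exists E : set Omega, [/\ measurable E, (P E <= eta%:E)%E &
    forall w, ~ E w -> forall p q, K p -> K q -> `|p - q| < delta ->
      `|trunc_process n p w - trunc_process n q w| <= eps].
Proof.
move=> eps0 eta0; have [M M0 HM] := bad_increments_le.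
have half0 : 0 < 2^-1 :> R by rewrite invr_gt0.
have r0 : 0 < r by rewrite powR_gt0.
have r1 : r < 1.
  have := @gt0_ltr_powR R (beta / 2) (divr_gt0 beta_gt0 (ltr0n R 2)) 2^-1 1.
  rewrite powR1; apply.
  - by rewrite nnegrE ltW.
  - by rewrite nnegrE ler01.
  - by rewrite invf_lt1// ltr1n.
have small (x c e : R) : 0 < x < 1 -> 0 < e ->
    \forall i \near \oo, c * x ^+ i <= e.
  move=> /andP[x0 x1] e0; have : geometric c x n @[n --> \oo] --> (0 : R).
    by apply: cvg_geometric; rewrite ger0_norm ?(ltW x0).
  move/cvgr0Pnorm_le => /(_ e e0); apply: filterS => i /=.
  by apply: le_trans; exact: ler_norm.
(* The first condition bounds the total probability of bad links from level [i0] on, the second the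
   oscillation given by chaining. Neither involves [n], so one [delta] serves every [n]. *)
have [i0 [i0eta i0eps]] : exists i0, 2 * M * 2^-1 ^+ i0 <= eta /\
    (1 + 2 / (1 - r)) * r ^+ i0 <= eps.
  have h1 : 2^-1 < 1 :> R by rewrite invf_lt1// ltr1n.
  have s1 := small 2^-1 (2 * M) eta; have s2 := small r (1 + 2 / (1 - r)) eps.
  rewrite half0 h1 in s1; rewrite r0 r1 in s2.
  have [N _ HN] := filterI (s1 isT eta0) (s2 isT eps0).
  by exists N; have [] := HN N (leqnn N).
exists (2^-1 ^+ i0); first by rewrite exprn_gt0.
move=> n n0; exists (\bigcup_j bad_increments n (i0 + j)); split.
- by apply: bigcupT_measurable => j; exact: measurable_bad_increments.
- apply: (@le_trans _ _ (\sum_(j <oo) P (bad_increments n (i0 + j)))%E).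
    apply: measure_sigma_subadditive => //.
      by move=> j; exact: measurable_bad_increments.
    by apply: bigcupT_measurable => j; exact: measurable_bad_increments.
  apply: (@le_trans _ _ (\sum_(j <oo) ((2 * M * 2^-1 ^+ i0) / (2 ^ j.+1)%:R)%:E)%E).
    apply: lee_nneseries => // j _; apply: le_trans (HM n (i0 + j)%N n0) _.
    rewrite lee_fin natrX exprD exprS !exprVn le_eqVlt.
    by apply/orP; left; apply/eqP; field; rewrite !gt_eqF ?exprn_gt0.
  apply: (@le_trans _ _ (2 * M * 2^-1 ^+ i0)%:E); last by rewrite lee_fin.
  by apply: epsilon_trick0; rewrite !mulr_ge0// exprn_ge0// ltW.
move=> w nEw p q Kp Kq pq; apply: le_trans i0eps; rewrite mulrC.
apply: (chaining (K := K) (X := fun p => trunc_process n p w) (net := net)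
  (M := 2 * n%:R) (beta := beta)) => //.
- by rewrite r0.
- by move=> ? ? ? ?; exact: trunc_process_holder.
move=> i s t i0i st; rewrite leNgt; apply/negP => Hst; apply: nEw.
exists (i - i0)%N => //; rewrite subnKC// /bad_increments.
by rewrite -bigcup_seq; exists (s, t).
Qed.

(** * The cost of truncation *)

Let exceeds (n : nat) (z : Rvec R dd) : R := \1_[set z | Num.sqrt n%:R < C z] z.

Definition env_tail n : R := \int[P]_w (C (Z 0%N w) ^+ 2 * exceeds n (Z 0%N w)).

Let exceeds_le n z : C z <= Num.sqrt n%:R -> exceeds n z = 0.
Proof. by move=> Cz; rewrite /exceeds indicE memNset//= ltNge Cz. Qed.

Let exceeds_gt n z : Num.sqrt n%:R < C z -> exceeds n z = 1.
Proof. by move=> Cz; rewrite /exceeds indicE mem_set. Qed.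

Let exceeds01 n z : 0 <= exceeds n z <= 1.
Proof.
by case: (leP (C z) (Num.sqrt n%:R)) => [/exceeds_le|/exceeds_gt] ->;
  rewrite lexx ler01.
Qed.

Let measurable_exceeds n : measurable_fun setT (fun w => exceeds n (Z 0%N w)).
Proof.
apply: (measurableT_comp _ (iid_measurable iidZ 0)).
exact/measurable_indic/measurable_gt_set.
Qed.

Let mC2 : measurable_fun setT (fun w => C (Z 0%N w) ^+ 2).
Proof. by have /integrableP[/measurable_EFinP] := iC2. Qed.

Lemma integrable_env_tail n :
  P.-integrable setT (EFin \o (fun w => C (Z 0%N w) ^+ 2 * exceeds n (Z 0%N w))).
Proof.
apply: le_integrable iC2 => //; first exact/measurable_EFinP/measurable_funM.
move=> w _; rewrite lee_fin normrM ler_piMr//.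
by have /andP[? ?] := exceeds01 n (Z 0%N w); rewrite ger0_norm.
Qed.

Lemma env_tail_cvg0 : env_tail n @[n --> \oo] --> 0.
Proof.
have [] := @dominated_convergence _ _ _ P setT measurableT
  (fun n w => (C (Z 0%N w) ^+ 2 * exceeds n (Z 0%N w))%:E) (fun=> 0%E)
  (fun w => (C (Z 0%N w) ^+ 2)%:E).
- by move=> n; have /integrableP[] := integrable_env_tail n.
- exact: measurable_cst.
- apply: aeW => w _; apply: cvg_near_cst.
  (* Once [n] passes the square of [C (Z 0 w)], the indicator vanishes at [w]. *)
  exists (Num.truncn (C (Z 0%N w) ^+ 2)).+1 => //= n /= Nn.
  rewrite exceeds_le ?mulr0// -[leLHS](gtr0_norm (C_gt0 _)) -sqrtr_sqr.
  by rewrite ler_wsqrtr// (le_trans (ltW (truncnS_gt _)))// ler_nat.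
- exact: iC2.
- apply: aeW => w n _; rewrite lee_fin normrM ger0_norm ?sqr_ge0// ler_piMr ?sqr_ge0//.
  by have /andP[? ?] := exceeds01 n (Z 0%N w); rewrite ger0_norm.
by move=> _ _; rewrite integral0 => /fine_cvg.
Qed.

(** The union bound gives [n P(C > sqrt n)], the mean of the constant [n] over [C > sqrt n], and
    there [n <= C^2]. *)
Lemma env_exceed_le n : (0 < n)%N ->
  (P (\big[setU/set0]_(i <- iota 0 n) [set w | (Num.sqrt n%:R < C (Z i w))%R])
   <= (env_tail n)%:E)%E.
Proof.
move=> n0; pose A0 := [set z | Num.sqrt n%:R < C z].
have mA0 : measurable A0 by exact: measurable_gt_set.
have mZ0 : measurable (Z 0%N @^-1` A0) by exact: (iid_measurable_preimage iidZ).
apply: (@le_trans _ _ (n%:R * fine (P (Z 0%N @^-1` A0)))%:E).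
  apply: measure_big_setU_le; rewrite ?size_iota// ?fine_ge0//.
    by move=> i _; exact: (iid_measurable_preimage iidZ i mA0).
  move=> i _; rewrite fineK ?fin_num_measure//.
  by case: (iidZ) => _ [H _]; rewrite -(H i A0 mA0).
rewrite lee_fin.
have -> : fine (P (Z 0%N @^-1` A0)) = \int[P]_w exceeds n (Z 0%N w).
  congr fine; have := @integral_indic _ _ _ P setT measurableT _ mZ0.
  by rewrite setIT => <-.
have iex : P.-integrable setT (EFin \o (fun w => exceeds n (Z 0%N w))).
  apply: (@bounded_integrable _ _ _ P _ 1) => // w.
  by have /andP[? ?] := exceeds01 n (Z 0%N w); rewrite ger0_norm.
rewrite -RintegralZl//; apply: le_Rintegral => //.
- exact: (integrableZl _ n%:R iex).
- exact: integrable_env_tail.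
move=> w _; case: (leP (C (Z 0%N w)) (Num.sqrt n%:R)) => Cz.
  by rewrite exceeds_le// !mulr0.
rewrite exceeds_gt// !mulr1 -[leLHS]sqr_sqrtr//.
by rewrite lerXn2r ?nnegrE ?sqrtr_ge0 ?(ltW (C_gt0 _))// ltW.
Qed.

(** When no [C (Z i w)] exceeds [sqrt n], truncation alters only the centering, by the mean of
    [h p - h q] over [C > sqrt n]. Since [|p - q| <= 1], that difference is at most [C], and
    [sqrt n C <= C^2] there. *)
Lemma emp_dev_le n w p q : (0 < n)%N -> K p -> K q -> `|p - q| <= 1 ->
  (forall i, (i < n)%N -> C (Z i w) <= Num.sqrt n%:R) ->
  Num.sqrt n%:R * `|emp_dev P Z (fun z => h p z - h q z) n w| <=
    `|trunc_process n p w - trunc_process n q w| + env_tail n.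
Proof.
move=> n0 Kp Kq pq1 Cw; set g := fun z => h p z - h q z.
have n0R : 0 < n%:R :> R by rewrite ltr0n.
have sn0 : 0 < Num.sqrt n%:R :> R by rewrite sqrtr_gt0.
have mg : measurable_fun setT g by apply: measurable_funB; exact: mh.
have ig : P.-integrable setT (EFin \o (fun w => g (Z 0%N w))).
  exact: (integrableB _ (ih Kp) (ih Kq)).
have itg := integrable_trunc n mg ig.
have Eg i : fine (\int[P]_v (g (Z i v))%:E) = \int[P]_v g (Z 0%N v).
  congr fine; apply: (iid_integral iidZ i (g := EFin \o g)).
  exact/measurable_EFinP.
pose e := \int[P]_v (g (Z 0%N v) - trunc g n (Z 0%N v)).
have devE : Num.sqrt n%:R * emp_dev P Z g n w =
    trunc_process n p w - trunc_process n q w - Num.sqrt n%:R * e.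
  rewrite trunc_process_sub// -/g /emp_dev /e RintegralB//.
  set a := \int[P]_v g _; set b := \int[P]_v trunc _ _ _.
  have -> : \sum_(j < n) (g (Z j w) - fine (\int[P]_v (g (Z j v))%:E)) =
      \sum_(i < n) (trunc g n (Z i w) - b) - n%:R * (a - b).
    rewrite mulr_natl -[X in _ - _ *+ X](card_ord n) -sumr_const -sumrB.
    apply: eq_bigr => i _; rewrite Eg truncE_le ?Cw ?ltn_ord// -/a; ring.
  rewrite -[X in _ * (X^-1 * _)](sqr_sqrtr (ltW n0R)).
  rewrite -[X in _ - X * _](sqr_sqrtr (ltW n0R)).
  by field; rewrite gt_eqF.
have e_le : Num.sqrt n%:R * `|e| <= env_tail n.
  rewrite mulrC -ler_pdivlMr// /env_tail mulrC.
  rewrite -RintegralZl//; last exact: integrable_env_tail.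
  have ige : P.-integrable setT (EFin \o (fun v => g (Z 0%N v) - trunc g n (Z 0%N v))).
    exact: (integrableB _ ig itg).
  apply: le_trans (le_normr_Rintegral measurableT ige) _.
  apply: le_Rintegral => //.
  - exact: (integrable_norm ige).
  - exact: (integrableZl _ (Num.sqrt n%:R)^-1 (integrable_env_tail n)).
  move=> v _; set z := Z 0%N v.
  case: (leP (C z) (Num.sqrt n%:R)) => Cz.
    by rewrite truncE_le// subrr normr0 exceeds_le// !mulr0.
  rewrite truncE_gt// subr0 exceeds_gt// mulr1 mulrC ler_pdivlMr//.
  have h1 : `|g z| <= C z.
    apply: le_trans (h_holder z Kp Kq) _; rewrite ler_piMr ?(ltW (C_gt0 z))//.
    have := @ge0_ler_powR R beta (ltW beta_gt0) `|p - q| 1.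
    by rewrite powR1; apply; rewrite ?nnegrE.
  by rewrite expr2 ler_pM// ltW.
rewrite -[X in X * _](gtr0_norm sn0) -normrM devE.
apply: le_trans (ler_normB _ _) _; rewrite lerD2l.
by rewrite normrM gtr0_norm.
Qed.

Lemma emp_dev_equicontinuous (eps eta : R) : 0 < eps -> 0 < eta ->
  exists2 delta : R, 0 < delta & exists N : nat, forall n, (N <= n)%N ->
  exists E : set Omega, [/\ measurable E, (P E <= eta%:E)%E &
    forall w, ~ E w -> forall p q, K p -> K q -> `|p - q| < delta ->
      Num.sqrt n%:R * `|emp_dev P Z (fun z => h p z - h q z) n w| <= eps].
Proof.
move=> eps0 eta0.
have e2 : 0 < eps / 2 by rewrite divr_gt0.
have h2 : 0 < eta / 2 by rewrite divr_gt0.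
have [delta delta0 Hdelta] := trunc_process_equicontinuous e2 h2.
(* The cap 1 is what the recentering estimate asks of [|p - q|]. *)
exists (Num.min delta 1); first by rewrite lt_min delta0 ltr01.
have m0 : 0 < Num.min (eps / 2) (eta / 2) by rewrite lt_min e2 h2.
have [N _ HN] := (cvgr0Pnorm_le _).1 env_tail_cvg0 _ m0.
exists N.+1 => n Nn; have n0 : (0 < n)%N by apply: leq_trans Nn.
have {HN} := HN n (ltnW Nn) => /(le_trans (ler_norm _)).
rewrite le_min => /andP[tail_eps tail_eta].
have [E [mE PE HE]] := Hdelta n n0.
set F := \big[setU/set0]_(i <- iota 0 n) [set w | Num.sqrt n%:R < C (Z i w)].
have mF : measurable F.
  apply: bigsetU_measurable => i _; apply: measurable_gt_set.
  exact: measurableT_comp (iid_measurable iidZ i).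
exists (E `|` F); split; first exact: measurableU.
- apply: le_trans (measureU2 P mE mF) _; rewrite [eta]splitr EFinD.
  apply: leeD => //; apply: le_trans (env_exceed_le n0) _.
  by rewrite lee_fin.
move=> w EFw p q Kp Kq; rewrite lt_min => /andP[pqd pq1].
rewrite [eps]splitr; apply: le_trans (emp_dev_le n0 Kp Kq (ltW pq1) _) _.
  move=> i ilt; rewrite leNgt; apply/negP => Ci; apply: EFw; right.
  by rewrite /F -bigcup_seq; exists i => //=; rewrite mem_iota.
by apply: lerD => //; apply: HE => // Ew; apply: EFw; left.
Qed.

End holder_class.

(** * Conditions (A1), (A3), (A4) and (A5) *)

Section regular_class.
Context {R : realType} {d : measure_display} {Omega : measurableType d}
  {P : probability Omega R} {m dd : nat} {Z : nat -> Omega -> Rvec R dd}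
  {Theta : set 'rV[R]_m} {G : 'rV[R]_m -> Rvec R dd -> R} {Phi : R -> \bar R}
  {beta : R} {C : nat -> Rvec R dd -> R}.
Local Notation phi := (conjPhi Phi).
Local Notation h := (hfun phi G).
Hypotheses (iidZ : iid P Z) (Theta_compact : compact Theta)
  (hPhi : Phi_assumptions Phi) (beta_gt0 : 0 < beta)
  (C_gt0 : forall k z, 0 < C k z)
  (C_sq : forall k, measurable_fun setT (C k) /\
    (\int[pushforward P (Z 0%N)]_z ((C k z) ^+ 2)%:E < +oo)%E)
  (C_holder : forall (k : nat) z th vt (x y : R), Theta th -> Theta vt ->
    `|x| <= k%:R -> `|y| <= k%:R ->
    `|phi (G th z + x) - phi (G vt z + y)| <=
      C k z * (eucl_dist (th, x) (vt, y)) `^ beta)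
  (mG : forall th, Theta th -> measurable_fun setT (G th)).

Definition index_set (k : nat) : set ('rV[R]_m * R) :=
  [set g | Theta g.1 /\ `|g.2| <= k%:R].

(** The Hölder constant for the sup norm; the extra factor comes from the Euclidean distance in
    [m + 1] coordinates. *)
Definition envelope k z := C k z * Num.sqrt m.+1%:R `^ beta.

Lemma envelope_gt0 k z : 0 < envelope k z.
Proof. by rewrite mulr_gt0// powR_gt0// sqrtr_gt0. Qed.

Lemma measurable_envelope k : measurable_fun setT (envelope k).
Proof. by apply: measurable_funM => //; case: (C_sq k). Qed.

Lemma integrable_envelope_sq k :
  P.-integrable setT (EFin \o (fun w => envelope k (Z 0%N w) ^+ 2)).
Proof.
have [mC C2] := C_sq k; have mZ0 := iid_measurable iidZ 0.
have mC2 : measurable_fun setT (fun z => C k z ^+ 2) by exact: measurable_funX.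
have iC2 : P.-integrable setT (EFin \o (fun w => C k (Z 0%N w) ^+ 2)).
  apply/integrableP; split; first exact/measurable_EFinP/(measurableT_comp mC2 mZ0).
  move: C2; have -> // := @ge0_integral_pushforward _ _ _ _ _ _ mZ0 P setT
    (fun z => (C k z ^+ 2)%:E) measurableT.
  - by under [X in _ -> is_true (X < _)%E]eq_integral do rewrite /= ger0_norm ?sqr_ge0//.
  - exact/measurable_EFinP.
  - by move=> z _; rewrite lee_fin sqr_ge0.
have := integrableZl measurableT ((Num.sqrt m.+1%:R `^ beta) ^+ 2) iC2.
by under [X in _ -> integrable _ _ X]eq_fun do rewrite /= exprMn mulrC EFinM.
Qed.

Lemma holder_norm k z p q : index_set k p -> index_set k q ->
  `|h p z - h q z| <= envelope k z * `|p - q| `^ beta.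
Proof.
move: p q => [th x] [vt y] [/= Tth xk] [/= Tvt yk].
apply: le_trans (C_holder z Tth Tvt xk yk) _.
rewrite /envelope -mulrA ler_wpM2l ?(ltW (C_gt0 _ _))// -powRM ?sqrtr_ge0//.
apply: ge0_ler_powR; rewrite ?nnegrE ?sqrtr_ge0 ?mulr_ge0 ?sqrtr_ge0 ?(ltW beta_gt0)//.
exact: eucl_dist_le_norm.
Qed.

Lemma measurable_hfun p : Theta p.1 -> measurable_fun setT (h p).
Proof.
move=> Tp; apply: (measurableT_comp (measurable_conjPhi hPhi)).
by apply: measurable_funD => //; exact: mG.
Qed.

Lemma Theta_bounded : exists L : nat, forall th, Theta th -> `|th| <= L%:R.
Proof.
have [M [_ HM]] := compact_bounded Theta_compact.
exists (Num.truncn (`|M| + 1)).+1 => th Tth.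
apply: le_trans (HM (`|M| + 1) _ th Tth) _; first by rewrite ltr_pwDr// ler_norm.
exact/ltW/truncnS_gt.
Qed.

Lemma index_set_bounded k : exists L : nat, forall p, index_set k p -> `|p| <= L%:R.
Proof.
have [L HL] := Theta_bounded; exists (maxn L k) => -[th x] [/= /HL thL xk].
by rewrite prod_normE natr_max/= ge_max !le_max thL xk orbT.
Qed.

(** The index set is bounded, so the distance can be absorbed in a constant. This carries
    integrability from one index to all others. *)
Lemma holder_bounded k : exists2 D : R, 0 <= D & forall z p q,
  index_set k p -> index_set k q -> `|h p z - h q z| <= envelope k z * D.
Proof.
have [L HL] := index_set_bounded k; exists ((L%:R + L%:R) `^ beta); first exact: powR_ge0.
move=> z p q Kp Kq; apply: le_trans (holder_norm z Kp Kq) _.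
rewrite ler_wpM2l ?(ltW (envelope_gt0 _ _))//.
apply: ge0_ler_powR; rewrite ?nnegrE ?addr_ge0 ?(ltW beta_gt0)//.
by rewrite (le_trans (ler_normB _ _))// lerD ?HL.
Qed.

Lemma powR_small (M e : R) : 0 < M -> 0 < e ->
  exists2 delta : R, 0 < delta & forall t, 0 <= t < delta -> M * t `^ beta < e.
Proof.
move=> M0 e0; have eM : 0 < e / M by rewrite divr_gt0.
exists ((e / M) `^ beta^-1); first by rewrite powR_gt0.
move=> t /andP[t0 td]; rewrite mulrC -ltr_pdivlMr//.
have -> : e / M = ((e / M) `^ beta^-1) `^ beta.
  by rewrite -powRrM mulVf ?gt_eqF// powRr1// ltW.
by apply: gt0_ltr_powR; rewrite ?nnegrE ?powR_ge0.
Qed.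

Lemma conj_shift_continuous z th (x e : R) : Theta th -> 0 < e ->
  exists2 delta : R, 0 < delta & forall vt, Theta vt -> `|th - vt| < delta ->
    `|phi (G th z + x) - phi (G vt z + x)| < e.
Proof.
move=> Tth e0; pose k := (Num.truncn `|x|).+1.
have [delta delta0 Hd] := powR_small (envelope_gt0 k z) e0.
exists delta => // vt Tvt thvt.
have xk : `|x| <= k%:R by exact/ltW/truncnS_gt.
have := @holder_norm k z (th, x) (vt, x) (conj Tth xk) (conj Tvt xk).
move=> /le_lt_trans; apply; apply: Hd; rewrite normr_ge0 prod_normE/= subrr normr0.
by rewrite gt_max thvt.
Qed.

Lemma G_lsc z th (a : R) : Theta th -> a < G th z ->
  exists2 delta : R, 0 < delta & forall vt, Theta vt -> `|th - vt| < delta ->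
    a < G vt z.
Proof.
move=> Tth /(conjPhi_separates hPhi)[x]; rewrite -subr_gt0 => gap.
have [delta delta0 Hd] := conj_shift_continuous z x Tth gap.
exists delta => // vt Tvt /(Hd vt Tvt) H; rewrite ltNge; apply/negP => Ga.
have : phi (G vt z + x) <= phi (a + x) by apply: conjPhi_nondecreasing => //; rewrite lerD2r.
by move: H; rewrite ltr_norml; lra.
Qed.

(** Together with lower semicontinuity this gives continuity in the parameter, on which the
    countable description of superlevel sets of [G] rests. *)
Lemma G_usc z th (a : R) : Theta th -> G th z < a ->
  exists2 delta : R, 0 < delta & forall vt, Theta vt -> `|th - vt| < delta ->
    G vt z < a.
Proof.
move=> Tth /(conjPhi_separates hPhi)[x]; rewrite -subr_gt0 => gap.
have [delta delta0 Hd] := conj_shift_continuous z x Tth gap.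
exists delta => // vt Tvt /(Hd vt Tvt) H; rewrite ltNge; apply/negP => Ga.
have : phi (a + x) <= phi (G vt z + x) by apply: conjPhi_nondecreasing => //; rewrite lerD2r.
by move: H; rewrite ltr_norml; lra.
Qed.

Lemma measurable_Theta_ball s (c : R) :
  measurable ([set th | Theta th /\ `|s - th| < c] : set (Rvec R m)).
Proof.
have -> : [set th | Theta th /\ `|s - th| < c] = Theta `&` ball s c.
  by rewrite mx_norm_ball.
have open_measurable (U : set 'rV[R]_m) : open U -> measurable (U : set (Rvec R m)).
  by move=> oU; exact: sub_sigma_algebra.
apply: measurableI; last by apply: open_measurable; exact: ball_open.
rewrite -(setCK Theta); apply: measurableC; apply: open_measurable.
by apply: closed_openC; apply: compact_closed => //; exact: norm_hausdorff.
Qed.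

(* Countably many parameter values suffice because G is continuous in the
   parameter. *)
Lemma condA1_of_holder : Theta !=set0 -> condA1 Theta G.
Proof.
move=> [th0 Tth0]; split; last first.
  move=> z th Tth a /(G_lsc Tth)[delta delta0 Hd].
  apply/nbhs_ballP; exists delta => //= vt; rewrite mx_norm_ball => vtd Tvt.
  exact: Hd.
(* At [k = 0] the index set is [Theta] times [{0}], so its nets provide nets of [Theta]. *)
have [L HL] := index_set_bounded 0.
have K0 : index_set 0 !=set0 by exists (th0, 0); split => //=; rewrite normr0.
have [A [B [net Hnet]]] := bounded_nets HL K0.
apply: (measurability _ (RGenOInfty.measurableE R)) => //.
move=> _ [_ [a ->] <-].
(* Twice the mesh, so that covering by closed balls becomes strict. *)
pose rad (i : nat) : R := 2 * 2^-1 ^+ i.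
have rad_lt (delta : R) : 0 < delta -> exists i0, forall i, (i0 <= i)%N -> rad i < delta.
  move=> delta0; have : geometric 2 2^-1 n @[n --> \oo] --> (0 : R).
    apply: cvg_geometric; rewrite ger0_norm ?invr_ge0//.
    by rewrite invf_lt1// ltr1n.
  move/cvgr0Pnorm_lt => /(_ delta delta0)[i0 _ Hi0].
  by exists i0 => i /Hi0/=; apply: le_lt_trans; exact: ler_norm.
pose F (r i : nat) : set (Rvec R m * Rvec R dd) :=
  \big[setU/set0]_(s <- net i)
    ([set th | Theta th /\ `|s.1 - th| < rad i] `*`
     [set z | a + r.+1%:R^-1 < G s.1 z]).
(* [G th z > a] holds exactly when, for some margin [1 / (r + 1)], every sufficiently fine net has a
   point near [th] at which [G] exceeds [a] by that margin. Lower semicontinuity gives one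
   inclusion, upper semicontinuity the other. *)
have -> : (Theta `*` setT) `&` ((fun p => G p.1 p.2) @^-1` `]a, +oo[%classic) =
    \bigcup_r \bigcup_i0 \bigcap_i F r (i0 + i)%N.
  apply/seteqP; split => -[th z] /=.
    rewrite in_itv/= andbT => -[[Tth _] aG].
    have [r Hr] : exists r : nat, a + r.+1%:R^-1 < G th z.
      exists (Num.truncn (G th z - a)^-1); rewrite -ltrBrDl.
      by rewrite invf_plt ?posrE ?subr_gt0// truncnS_gt.
    have [delta delta0 Hd] := G_lsc Tth Hr.
    have [i0 Hi0] := rad_lt _ delta0.
    exists r => //; exists i0 => // i _; rewrite /F -bigcup_seq.
    have [_ _ /(_ (th, 0))[|s sn ths]] := Hnet (i0 + i)%N.
      by split => //=; rewrite normr0.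
    have [_ + _] := Hnet (i0 + i)%N.
    have [Ts _] : index_set 0 s by have [+ _ _] := Hnet (i0 + i)%N; exact.
    have {}ths : `|th - s.1| < rad (i0 + i)%N.
      move: ths; rewrite prod_normE ge_max => /andP[+ _] => /le_lt_trans; apply.
      have : 0 < 2^-1 ^+ (i0 + i) :> R by rewrite exprn_gt0// invr_gt0.
      by rewrite /rad; lra.
    move=> _; exists s => //=; split; first by rewrite distrC.
    by apply: Hd => //; apply: lt_trans ths (Hi0 _ _); exact: leq_addr.
  move=> [r _ [i0 _ Hi]].
  have Tth : Theta th.
    by have := Hi 0%N I; rewrite /F -bigcup_seq => -[s _ [[]]].
  split => //; rewrite in_itv/= andbT ltNge; apply/negP => Ga.
  have [|delta delta0 Hd] := @G_usc z th (a + r.+1%:R^-1) Tth.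
    by rewrite (le_lt_trans Ga)// ltrDl invr_gt0.
  have [j Hj] := rad_lt _ delta0.
  have := Hi j I; rewrite /F -bigcup_seq => -[s sn [/= [_ sth] Gs]].
  have [Ts _] : index_set 0 s by have [+ _ _] := Hnet (i0 + j)%N; exact.
  suff : G s.1 z < a + r.+1%:R^-1 by rewrite ltNge (ltW Gs).
  by apply: Hd => //; rewrite distrC (lt_trans sth)// Hj// leq_addl.
apply: bigcupT_measurable => r; apply: bigcupT_measurable => i0.
apply: bigcapT_measurable => i; rewrite /F big_seq; apply: bigsetU_measurable => s sn.
have [Ts _] : index_set 0 s by have [+ _ _] := Hnet (i0 + i)%N; exact.
apply: measurableX; first exact: measurable_Theta_ball.
by apply: measurable_gt_set; exact: mG.
Qed.

(** * Integrability spread from one square integrable member *)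

Context {thb : 'rV[R]_m} {xb : R}.
Hypotheses (Tthb : Theta thb)
  (sqb : sq_integrable P (fun w => phi (G thb (Z 0%N w) + xb))).

Lemma index_set_exhaust (x : R) : exists k : nat, `|x| <= k%:R /\ `|xb| <= k%:R.
Proof.
exists (Num.truncn (Num.max `|x| `|xb|)).+1.
have := ltW (truncnS_gt (Num.max `|x| `|xb|)).
by rewrite ge_max => /andP.
Qed.

Lemma measurable_hfunZ p : Theta p.1 -> measurable_fun setT (fun w => h p (Z 0%N w)).
Proof.
by move=> Tp; exact: (measurableT_comp (measurable_hfun Tp) (iid_measurable iidZ 0)).
Qed.

Lemma integrable_of_sq (X : Omega -> R) : measurable_fun setT X ->
  P.-integrable setT (EFin \o (fun w => X w ^+ 2)) -> P.-integrable setT (EFin \o X).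
Proof.
move=> mX iX2.
have i1 : P.-integrable setT (EFin \o (fun=> 1 : R)).
  by apply: (@bounded_integrable _ _ _ P _ 1) => // w; rewrite normr1.
apply: le_integrable (integrableD _ i1 iX2) => //; first exact/measurable_EFinP.
move=> w _; rewrite lee_fin/= [leRHS]ger0_norm ?addr_ge0 ?sqr_ge0//.
rewrite -[X w ^+ 2]real_normK ?num_real//.
have := sqr_ge0 (`|X w| - 1); rewrite sqrrB1; have := normr_ge0 (X w).
have := sqr_ge0 `|X w|; lra.
Qed.

Lemma integrable_hfun_sq p : Theta p.1 ->
  P.-integrable setT (EFin \o (fun w => h p (Z 0%N w) ^+ 2)).
Proof.
move=> Tp; have [k [pk xbk]] := index_set_exhaust p.2.
have [D D0 HD] := holder_bounded k.
have [mb b2] := sqb.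
have mhp := measurable_hfunZ Tp.
have ib : P.-integrable setT (EFin \o (fun w => h (thb, xb) (Z 0%N w) ^+ 2)).
  apply/integrableP; split; first exact/measurable_EFinP/measurable_funX.
  by under [X in (X < _)%E]eq_integral do rewrite /= ger0_norm ?sqr_ge0//.
have ibound : P.-integrable setT (EFin \o (fun w => 2 * h (thb, xb) (Z 0%N w) ^+ 2 +
    (2 * D ^+ 2) * envelope k (Z 0%N w) ^+ 2)).
  exact: (integrableD _ (integrableZl _ 2 ib)
    (integrableZl _ (2 * D ^+ 2) (integrable_envelope_sq k))).
apply: le_integrable ibound => //; first exact/measurable_EFinP/measurable_funX.
move=> w _; rewrite lee_fin/=.
have := HD (Z 0%N w) p (thb, xb) (conj Tp pk) (conj Tthb xbk).
set u := h p _; set v := h (thb, xb) _; set c := envelope _ _ => huv.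
rewrite ger0_norm ?sqr_ge0// (le_trans _ (ler_norm _))//.
have h1 : (u - v) ^+ 2 <= (c * D) ^+ 2.
  rewrite -[leLHS]real_normK ?num_real// lerXn2r ?nnegrE//.
  by rewrite mulr_ge0// ltW// envelope_gt0.
(* [2 v^2 + 2 (u - v)^2 - u^2] is the square of [u - 2 v]. *)
have := sqr_ge0 (u - 2 * v); move: h1; rewrite exprMn; nra.
Qed.

Lemma integrable_hfun p : Theta p.1 ->
  P.-integrable setT (EFin \o (fun w => h p (Z 0%N w))).
Proof.
move=> Tp; apply: integrable_of_sq; first exact: measurable_hfunZ.
exact: integrable_hfun_sq.
Qed.

(** The base member plus a multiple of the envelope dominates the whole class. The majorant serves
    as [xi2] in (A3) and as the uniform bound on means in (A4). *)
Lemma hfun_majorant k : exists2 F : Rvec R dd -> R,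
  measurable_fun setT F /\ P.-integrable setT (EFin \o (fun w => F (Z 0%N w))) &
  forall z p, index_set k p -> `|h p z| <= F z.
Proof.
have [k' [kk' xbk']] := index_set_exhaust k%:R.
have [D D0 HD] := holder_bounded k'.
have mh0 : measurable_fun setT (h (thb, xb)) by exact: measurable_hfun.
exists (fun z => `|h (thb, xb) z| + D * envelope k' z); first split.
- apply: measurable_funD; first exact: measurableT_comp.
  by apply: measurable_funM => //; exact: measurable_envelope.
- have ie : P.-integrable setT (EFin \o (fun w => envelope k' (Z 0%N w))).
    apply: integrable_of_sq (integrable_envelope_sq k').
    exact: (measurableT_comp (measurable_envelope k') (iid_measurable iidZ 0)).
  exact: (integrableD _ (integrable_norm (integrable_hfun (p := (thb, xb)) Tthb))
    (integrableZl _ D ie)).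
- move=> z p [Tp pk].
  have pk' : `|p.2| <= k'%:R by apply: le_trans pk _; rewrite ger0_norm in kk'.
  have := HD z p (thb, xb) (conj Tp pk') (conj Tthb xbk').
  have := ler_distD (h (thb, xb) z) (h p z) 0; rewrite !subr0; lra.
Qed.

Lemma condA3_of_holder :
  (forall th, Theta th -> Hclass P phi (fun w => G th (Z 0%N w))) ->
  condA3 P Z Theta phi G.
Proof.
move=> Gclass; split => //.
have [F [mF iF] HF] := hfun_majorant 0.
exists F; split.
  apply: (integrable_pushforward (iid_measurable iidZ 0)) => //.
  exact/measurable_EFinP.
move=> z; apply: ge_ereal_sup => _ [th /= Tth <-].
have := HF z (th, 0); rewrite /hfun/= addr0 lee_fin; apply.
by split => //=; rewrite normr0.
Qed.

Lemma condA4_of_holder : condA4 P Z Theta phi G.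
Proof.
split.
  move=> th x Tth; have := integrable_hfun_sq (p := (th, x)) Tth.
  move=> /integrableP[mh2 fin2]; split; first exact: (measurable_hfunZ (p := (th, x))).
  move: fin2; by under eq_integral do rewrite /= ger0_norm ?sqr_ge0//.
move=> k; have [F [mF iF] HF] := hfun_majorant k.
apply: (@le_lt_trans _ _ (\int[P]_w (F (Z 0%N w))%:E)%E).
  apply: ge_ereal_sup => _ [p /= [Tp pk] <-].
  apply: le_integral => //; first exact: (integrable_hfun Tp).
  move=> w _; rewrite lee_fin; apply: le_trans (ler_norm _) _.
  by apply: HF.
have := integrable_fin_num measurableT iF; rewrite fin_numElt => /andP[_].
exact.
Qed.

(** The measurable exceptional set competes in the infimum defining the outer probability: off this
    set all increments are at most [eps], so it contains the event where their supremum exceeds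
    [eps]. *)
Lemma condA5_of_holder : condA5 P Z Theta phi G (@eucl_dist R m).
Proof.
move=> eps eps0 k.
have [L HL] := index_set_bounded k.
have K0 : index_set k !=set0 by exists (thb, 0); split => //=; rewrite normr0.
have [A [B [net Hnet]]] := bounded_nets HL K0.
have equi := @emp_dev_equicontinuous R d Omega P dd Z iidZ _ (index_set k) h
  (envelope k) beta beta_gt0 (envelope_gt0 k) (measurable_envelope k)
  (integrable_envelope_sq k) (fun p Kp => measurable_hfun Kp.1)
  (fun p Kp => integrable_hfun Kp.1) (@holder_norm k) net A B
  (fun i => let: And3 H _ _ := Hnet i in H)
  (fun i => let: And3 _ H _ := Hnet i in H)
  (fun i => let: And3 _ _ H := Hnet i in H) eps _ eps0.
pose u (delta : R) (n : nat) := Pouter P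
  [set w | (eps%:E < ereal_sup
    [set (Num.sqrt n%:R * `|emp_dev P Z (fun z => h gg.1 z - h gg.2 z) n w|)%:E
    | gg in [set gg : ('rV[R]_m * R) * ('rV[R]_m * R) |
        ([/\ Theta gg.1.1, `|gg.1.2| <= k%:R, Theta gg.2.1, `|gg.2.2| <= k%:R &
          eucl_dist gg.1 gg.2 < delta])%R]])%E].
have u_ge0 delta n : (0 <= u delta n)%E.
  by apply: le_ereal_inf_tmp => _ [E [mE _] <-]; exact: measure_ge0.
have esup_ge0 delta : (0 <= limn_esup (u delta))%E.
  apply: le_ereal_inf_tmp => _ [V [N _ NV] <-].
  apply: le_trans (u_ge0 delta N) _; apply: ereal_sup_ubound; exists N => //.
  by apply: NV => /=.
have esup_le eta : 0 < eta -> exists2 delta0 : R, 0 < delta0 &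
    forall delta, delta < delta0 -> (limn_esup (u delta) <= eta%:E)%E.
  move=> /equi[delta0 delta00 [N HN]]; exists delta0 => // delta ltd.
  (* The limit superior is an infimum over neighbourhoods of infinity, so the tail from [N] on
     bounds it. *)
  apply: (@le_trans _ _ (ereal_sup (u delta @` [set n | (N <= n)%N]))).
    by apply: ereal_inf_lbound; exists [set n | (N <= n)%N] => //; exists N.
  apply: ge_ereal_sup => _ [n /= Nn <-].
  have [E [mE PE HE]] := HN n Nn; apply: le_trans PE.
  apply: ereal_inf_lbound; exists E => //; split => // w /= Hw.
  apply: contrapT => nEw; move: Hw; rewrite ltNge => /negP; apply.
  apply: ge_ereal_sup => _ [[p q] /= [Tp pk Tq qk pq] <-].
  rewrite lee_fin; apply: HE => //.
  by rewrite (le_lt_trans (norm_le_eucl_dist p q))// (lt_trans pq).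
have : limn_esup (u delta) @[delta --> 0^'+] --> 0%:E; last by [].
apply/fine_cvgP; split.
  have [delta0 delta00 Hd] := esup_le 1 ltr01.
  near=> delta; rewrite ge0_fin_numE//.
  by apply: le_lt_trans (Hd delta _) _; rewrite ?ltry//; near: delta; exact: nbhs_right_lt.
apply/(cvgr0Pnorm_le (fine \o (fun delta => limn_esup (u delta)))) => eta eta0.
have [delta0 delta00 Hd] := esup_le eta eta0.
near=> delta => /=.
have le_eta : (limn_esup (u delta) <= eta%:E)%E.
  by apply: Hd; near: delta; exact: nbhs_right_lt.
rewrite ger0_norm ?fine_ge0// -lee_fin fineK// ge0_fin_numE//.
by apply: le_lt_trans le_eta _; rewrite ltry.
Unshelve. all: by end_near.
Qed.

End regular_class.

Unset Implicit Arguments.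

Theorem theorem5p2 (R : realType) (d : measure_display) (Omega : measurableType d)
    (P : probability Omega R) (m dd : nat) (Z : nat -> Omega -> Rvec R dd)
    (Theta : set 'rV[R]_m) (G : 'rV[R]_m -> Rvec R dd -> R) (Phi : R -> \bar R) :
  iid P Z ->
  Theta !=set0 -> compact Theta ->
  Phi_assumptions Phi ->
  condH P Z Theta (conjPhi Phi) G ->
  (forall th, Theta th -> measurable_fun setT (G th)) ->
  (forall th, Theta th -> Hclass P (conjPhi Phi) (fun w => G th (Z 0%N w))) ->
  (exists2 thb, Theta thb & exists xb : R,
     sq_integrable P (fun w => conjPhi Phi (G thb (Z 0%N w) + xb))) ->
  [/\ condA1 Theta G,
      condA3 P Z Theta (conjPhi Phi) G,
      condA4 P Z Theta (conjPhi Phi) G &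
      condA5 P Z Theta (conjPhi Phi) G (@eucl_dist R m)].
Proof.
move=> iidZ Theta0 Theta_compact hPhi [beta /andP[beta_gt0 _] [C [C_gt0 [C_sq C_holder]]]].
move=> mG Gclass [thb Tthb [xb sqb]]; split.
- exact: (condA1_of_holder Theta_compact hPhi beta_gt0 C_gt0 C_holder).
- exact: (condA3_of_holder iidZ Theta_compact hPhi beta_gt0 C_gt0 C_sq C_holder mG Tthb sqb).
- exact: (condA4_of_holder iidZ Theta_compact hPhi beta_gt0 C_gt0 C_sq C_holder mG Tthb sqb).
- exact: (condA5_of_holder iidZ Theta_compact hPhi beta_gt0 C_gt0 C_sq C_holder mG Tthb sqb).
Qed.
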